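(* Fix $\varepsilon\in(0,1]$. Consider models of horizon $T$ satisfying the strong mixing assumption with $\boldsymbol{\epsilon}_T\ge\varepsilon$ (see context), and let $P_{T,N}$ denote the Markov transition probability on $\mathsf{X}^T$ of the conditional backward sampling particle filter (CBPF) with $N$ particles. For any $\rho>0$ there exists $N_0=N_0(\varepsilon,\rho)<\infty$ such that for all $N\ge N_0$, for any family of such models, one for each horizon $T\ge 1$, $$\lim_{T\to\infty}\ \sup_{x\in\mathsf{X}^T}\big\|P_{T,N}^{\lceil \rho T\rceil}(x,\cdot)-\pi_T\big\|_{\mathrm{tv}}=0.\qquad(\ast)$$ More precisely, for any $\alpha,\beta\in(1,\infty)$ there exists $N_0=N_0(\varepsilon,\alpha,\beta)\in\mathbb{N}$ such that for all $N\ge N_0$: (i) $\sup_{x\in\mathsf{X}^T}\|P_{T,N}^k(x,\cdot)-\pi_T\|_{\mathrm{tv}}\le \alpha^T\beta^{-k}$ for all $k\ge1$, all $T\ge1$ and every such model of horizon $T$; (ii) for any $\rho>\log\alpha/\log\beta$, $(\ast)$ holds.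
   Context: Model. $\mathsf{X}$ is a measurable space with a $\sigma$-finite measure written $\mathrm{d}x$; products carry product measures. A model of horizon $T$ consists of a probability density $M_1$ on $\mathsf{X}$, Markov transition densities $M_t(x_{t-1},x_t)$ (densities in $x_t$), $t=2,\dots,T$, and measurable potentials $G_1:\mathsf{X}\to[0,\infty)$, $G_t:\mathsf{X}^2\to[0,\infty)$, $t=2,\dots,T$. Put $\gamma_T(x_{1:T})=M_1(x_1)G_1(x_1)\prod_{t=2}^T M_t(x_{t-1},x_t)G_t(x_{t-1},x_t)$; assume $c_T=\int\gamma_T(x_{1:T})\,\mathrm{d}x_{1:T}\in(0,\infty)$, and let $\pi_T=\gamma_T/c_T$, a probability density on $\mathsf{X}^T$ (also denoting the corresponding measure). Strong mixing assumption. $G_*(1)=\inf_x G_1(x)>0$, $G^*(1)=\sup_x G_1(x)<\infty$, and for all $t=2,\dots,T$: $M_*(t)=\inf_{x,y}M_t(x,y)>0$, $M^*(t)=\sup_{x,y}M_t(x,y)<\infty$, $G_*(t)=\inf_{x,y}G_t(x,y)>0$, $G^*(t)=\sup_{x,y}G_t(x,y)<\infty$. Set $$\boldsymbol{\epsilon}_T=\min_{t=1,\dots,T-1}\frac{G_*(t)M_*(t+1)G_*(t+1)}{G^*(t)M^*(t+1)G^*(t+1)},$$ with $\boldsymbol{\epsilon}_1=G_*(1)/G^*(1)$ when $T=1$. Notation. $\mathrm{Categ}(\omega^{(1:N)})$ is the law on $\{1,\dots,N\}$ with $\mathbb{P}(I=i)=\omega^{(i)}/\sum_j\omega^{(j)}$.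 $\|\mu-\nu\|_{\mathrm{tv}}=\sup_{|f|\le1}|\mu(f)-\nu(f)|$. $P^k$ is the $k$-step kernel. CBPF with $N\ge2$ particles and input (reference) $X^*_{1:T}\in\mathsf{X}^T$: 1. Set $X_{1:T}^{(1)}=X_{1:T}^*$; draw $X_1^{(i)}\sim M_1$ independently for $i=2,\dots,N$; $\omega_1^{(i)}=G_1(X_1^{(i)})$ for $i=1,\dots,N$. 2. For $t=2,\dots,T$: set $I_t^{(1)}=1$; (conditionally) independently for $i=2,\dots,N$ draw $I_t^{(i)}\sim\mathrm{Categ}(\omega_{t-1}^{(1:N)})$ and $X_t^{(i)}\sim M_t(X_{t-1}^{(I_t^{(i)})},\cdot)$; set $\omega_t^{(i)}=G_t(X_{t-1}^{(I_t^{(i)})},X_t^{(i)})$ for $i=1,\dots,N$. 3. Draw $J_T\sim\mathrm{Categ}(\omega_T^{(1:N)})$. For $t=T-1,\dots,1$: $b_t^{(i)}=\omega_t^{(i)}M_{t+1}(X_t^{(i)},X_{t+1}^{(J_{t+1})})G_{t+1}(X_t^{(i)},X_{t+1}^{(J_{t+1})})$ and $J_t\sim\mathrm{Categ}(b_t^{(1:N)})$. 4. Output $X_{1:T}^{(J_{1:T})}=(X_1^{(J_1)},\dots,X_T^{(J_T)})$. $P_{T,N}(x,\cdot)$ is the law of the output given reference $x$. *)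

(* Defs.v *)
From HB Require Import structures.
From mathcomp Require Import all_boot all_order all_algebra.
From mathcomp Require Import all_classical all_reals all_analysis.
From mathcomp Require Import measurable_realfun giry.

Set Implicit Arguments.
Unset Strict Implicit.
Unset Printing Implicit Defensive.
Import Order.TTheory GRing.Theory Num.Theory.
Import numFieldNormedType.Exports.

Local Open Scope classical_set_scope.
Local Open Scope ring_scope.
Local Open Scope ereal_scope.

HB.instance Definition _ n := isPointed.Build 'I_n.+1 ord0.
HB.instance Definition _ n := @isMeasurable.Build default_measure_display
  'I_n.+1 discrete_measurable discrete_measurable0
  discrete_measurableC discrete_measurableU.

Section density.
Context d (X : measurableType d) (R : realType).
Variable mu : {measure set X -> \bar R}.

Definition is_density (p : X -> R) : Prop :=
  [/\ measurable_fun [set: X] p, (forall x, 0 <= p x)%R &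
      \int[mu]_x (p x)%:E = 1].

Section law.
Variables (p : X -> R) (hp : is_density p).

Definition density_law (A : set X) : \bar R := \int[mu]_(x in A) (p x)%:E.

Let density_law0 : density_law set0 = 0.
Proof. exact: integral_set0. Qed.

Let density_law_ge0 A : 0 <= density_law A.
Proof. by case: hp => _ p0 _; apply: integral_ge0 => x _; rewrite lee_fin. Qed.

Let density_law_sigma_additive : semi_sigma_additive density_law.
Proof.
case: hp => mp p0 _ /= F mF tF mUF; rewrite /density_law ge0_integral_bigcup//=.
- apply: is_cvg_ereal_nneg_natsum_cond => k _ _; apply: integral_ge0 => x _.
  by rewrite lee_fin.
- by apply: measurable_funTS; apply/measurable_EFinP.
- by move=> x _; rewrite lee_fin.
Qed.

HB.instance Definition _ := isMeasure.Build _ _ _ density_law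
  density_law0 density_law_ge0 density_law_sigma_additive.

Let density_law_setT : density_law [set: X] <= 1.
Proof. by case: hp => _ _ <-. Qed.

HB.instance Definition _ :=
  Measure_isSubProbability.Build _ _ _ density_law density_law_setT.

Definition density_giry : giry X R := density_law.

End law.

(* Total version of [density_giry]: the zero measure if [p] is not a probability
   density. In the sampler below this default is never used under strong mixing,
   see [cbpf_setT]. *)
Definition draw (p : X -> R) : giry X R :=
  if pselect (is_density p) is left hp then density_giry hp else mzero.

End density.

Section bind.
Context d1 d2 (A : measurableType d1) (B : measurableType d2) (R : realType).

(* Total version of [giry_bind]: the zero measure if [f] is not measurable. All
   continuations bound below are measurable, see [measurable_cbpf]. *)
Definition bind (m : giry A R) (f : A -> giry B R) : giry B R :=
  if pselect (measurable_fun [set: A] f) is left mf then giry_bind m mf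
  else mzero.

End bind.

Section iid.
Context d (A : measurableType d) (R : realType).

Fixpoint iid (n : nat) (m : giry A R) : giry (n.-tuple A) R :=
  if n is k.+1 then
    bind m (fun a => bind (iid k m) (fun s => giry_ret (cons_tuple a s)))
  else giry_ret [tuple].

End iid.

Definition categ (R : realType) (n : nat) (w : 'I_n.+1 -> R) : giry 'I_n.+1 R :=
  draw (@counting 'I_n.+1 R) (fun i => w i / \sum_j w j)%R.

Section tuple_power.
Context d (X : measurableType d) (R : realType).
Variable mu : {sigma_finite_measure set X -> \bar R}.

Section cons.
Variables (n : nat) (nu : {sigma_finite_measure set (n.-tuple X) -> \bar R}).

(* Image of [mu \x nu] under [cons]. *)
Definition cons_measure (A : set (n.+1.-tuple X)) : \bar R :=
  (mu \x nu) [set z | A (cons_tuple z.1 z.2)].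

Lemma measurable_cons_tuple :
  measurable_fun [set: (X * n.-tuple X)%type] (fun z => cons_tuple z.1 z.2).
Proof. exact: measurable_cons. Qed.

Let mpre A : measurable A ->
  measurable [set z : X * n.-tuple X | A (cons_tuple z.1 z.2)].
Proof. by move=> mA; rewrite -[X in measurable X]setTI; exact: measurable_cons_tuple. Qed.

Let cons_measure0 : cons_measure set0 = 0.
Proof. exact: measure0. Qed.

Let cons_measure_ge0 A : 0 <= cons_measure A.
Proof. exact: measure_ge0. Qed.

Let cons_measure_sigma_additive : semi_sigma_additive cons_measure.
Proof.
move=> F mF tF mUF.
apply: (@measure_semi_sigma_additive _ _ _ (mu \x nu)
  (fun i => [set z : X * n.-tuple X | F i (cons_tuple z.1 z.2)])).
- by move=> i; exact: mpre.
- move/trivIsetP : tF => tF; apply/trivIsetP => i j _ _ ij.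
  apply/seteqP; split => // z [zi zj].
  have /seteqP[h _] := tF i j Logic.I Logic.I ij.
  exact: (h (cons_tuple z.1 z.2)).
- exact: (mpre mUF).
Qed.

HB.instance Definition _ := isMeasure.Build _ _ _ cons_measure
  cons_measure0 cons_measure_ge0 cons_measure_sigma_additive.

Let cons_measure_sigma_finite : sigma_finite [set: n.+1.-tuple X] cons_measure.
Proof.
have /sigma_finiteP[F [TF ndF Foo]] := sigma_finiteT mu.
have /sigma_finiteP[G [TG ndG Goo]] := sigma_finiteT nu.
pose u (x : n.+1.-tuple X) := (thead x, [tuple of behead x]).
have mu' : measurable_fun setT u.
  by apply: measurable_fun_pair; [exact: measurable_tnth|exact: measurable_behead].
exists (fun k => u @^-1` (F k `*` G k)).
  apply/seteqP; split => // x _.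
  have [i _ Fi] : (\bigcup_i F i) (u x).1 by rewrite -TF.
  have [j _ Gj] : (\bigcup_j G j) (u x).2 by rewrite -TG.
  exists (maxn i j) => //; split.
    by move: Fi; exact/subsetPset/ndF/leq_maxl.
  by move: Gj; exact/subsetPset/ndG/leq_maxr.
move=> k; have [mFk Fk] := Foo k; have [mGk Gk] := Goo k; split.
  by rewrite -[X in measurable X]setTI; apply: mu' => //; exact: measurableX.
rewrite /cons_measure (_ : [set _ | _] = F k `*` G k).
  by rewrite product_measure1E// lte_mul_pinfty// ge0_fin_numE.
apply/seteqP; split=> -[a s];
  by rewrite /u /= theadE (_ : [tuple of _] = s)//; apply/val_inj.
Qed.

HB.instance Definition _ := Measure_isSigmaFinite.Build _ _ _ cons_measure
  cons_measure_sigma_finite.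

End cons.

Fixpoint tuple_measure (n : nat) : {sigma_finite_measure set (n.-tuple X) -> \bar R} :=
  if n is k.+1 then cons_measure (tuple_measure k)
  else \d_([tuple] : 0.-tuple X).

End tuple_power.

(* Times are 1-based: [coord x t] is x_t for 1 <= t <= T. *)
Definition coord d (X : measurableType d) T (x : T.-tuple X) (t : nat) : X :=
  nth point x t.-1.

Section model.
Context d (X : measurableType d) (R : realType).
Variable mu : {sigma_finite_measure set X -> \bar R}.

Definition path_weight (M1 : X -> R) (M : nat -> X -> X -> R)
    (G1 : X -> R) (G : nat -> X -> X -> R) (T : nat) (x : T.-tuple X) : R :=
  (M1 (coord x 1%N) * G1 (coord x 1%N) *
   \prod_(2 <= t < T.+1) (M t (coord x t.-1) (coord x t) *
                          G t (coord x t.-1) (coord x t)))%R.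

(* [M t] and [G t] are the transition density and potential of time t; their
   values outside 2 <= t <= T are unconstrained and never used. *)
Record model (T : nat) := Model {
  M1 : X -> R ;
  M : nat -> X -> X -> R ;
  G1 : X -> R ;
  G : nat -> X -> X -> R ;
  gamma := @path_weight M1 M G1 G T ;
  normc := \int[tuple_measure mu T]_x (gamma x)%:E ;
  M1_density : is_density mu M1 ;
  M_measurable : forall t, (2 <= t <= T)%N ->
    measurable_fun [set: X * X] (fun z => M t z.1 z.2) ;
  M_density : forall t, (2 <= t <= T)%N -> forall x, is_density mu (M t x) ;
  G1_measurable : measurable_fun [set: X] G1 ;
  G1_ge0 : forall x, (0 <= G1 x)%R ;
  G_measurable : forall t, (2 <= t <= T)%N ->
    measurable_fun [set: X * X] (fun z => G t z.1 z.2) ;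
  G_ge0 : forall t, (2 <= t <= T)%N -> forall x y, (0 <= G t x y)%R ;
  normc_gt0 : 0 < normc ;
  normc_lty : normc < +oo
}.

Section mixing.
Context T (m : model T).

Definition G_inf t : \bar R :=
  if t == 1%N then ereal_inf (range (fun x => (G1 m x)%:E))
  else ereal_inf (range (fun z => (G m t z.1 z.2)%:E)).
Definition G_sup t : \bar R :=
  if t == 1%N then ereal_sup (range (fun x => (G1 m x)%:E))
  else ereal_sup (range (fun z => (G m t z.1 z.2)%:E)).
Definition M_inf t : \bar R := ereal_inf (range (fun z => (M m t z.1 z.2)%:E)).
Definition M_sup t : \bar R := ereal_sup (range (fun z => (M m t z.1 z.2)%:E)).

Definition strong_mixing : Prop :=
  (forall t, (1 <= t <= T)%N -> 0 < G_inf t /\ G_sup t < +oo) /\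
  (forall t, (2 <= t <= T)%N -> 0 < M_inf t /\ M_sup t < +oo).

Definition mixing_ratio t : R :=
  ((fine (G_inf t) * fine (M_inf t.+1) * fine (G_inf t.+1)) /
   (fine (G_sup t) * fine (M_sup t.+1) * fine (G_sup t.+1)))%R.

(* For T >= 2 the default [mixing_ratio 1] of the iterated minimum is itself one
   of the terms. *)
Definition mixing_eps : R :=
  if T == 1%N then (fine (G_inf 1%N) / fine (G_sup 1%N))%R
  else \big[Num.min/mixing_ratio 1%N]_(1 <= t < T) mixing_ratio t.

End mixing.

Definition target T (m : model T) : giry (T.-tuple X) R :=
  draw (tuple_measure mu T) (fun x => gamma m x / fine (normc m))%R.

(* The weight at time t of a particle, given as the pair (position of its
   ancestor at time t - 1, own position). At time 1 the first component is a
   dummy. *)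
Definition potential T (m : model T) (t : nat) (z : X * X) : R :=
  if t == 1%N then G1 m z.2 else G m t z.1 z.2.

(* The sampler with N = n.+1 particles for a horizon T.+1; particle [ord0] is the
   reference. *)
Section cbpf.
Context T (m : model T.+1) (n : nat).

Local Notation cloud := (n.+1.-tuple (X * X)%type).

(* A cloud stores, for each particle i, the pair (X_{t-1}^{(I_t^{(i)})}, X_t^{(i)});
   see [potential]. *)
Definition init (x : X) : giry cloud R :=
  bind (iid n (bind (draw mu (M1 m)) (fun y => giry_ret (y, y)))) (fun s =>
  giry_ret (cons_tuple (x, x) s)).

Definition propagate t (s : cloud) : giry (X * X)%type R :=
  bind (categ (fun i => potential m t (tnth s i))) (fun a =>
  bind (draw mu (M m t.+1 (tnth s a).2)) (fun y =>
  giry_ret ((tnth s a).2, y))).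

(* From time t to time t + 1, the reference moving to [x]. *)
Definition step t (s : cloud) (x : X) : giry cloud R :=
  bind (iid n (propagate t s)) (fun s' =>
  giry_ret (cons_tuple ((tnth s ord0).2, x) s')).

Definition back_weight t (s : cloud) (y : X) (i : 'I_n.+1) : R :=
  (potential m t (tnth s i) * M m t.+1 (tnth s i).2 y * G m t.+1 (tnth s i).2 y)%R.

(* Given the cloud [s] at time t, the law of (X_t^{(J_t)}, ..., X_{t+k}^{(J_{t+k})}),
   where t + k is the horizon. The calls perform the forward pass up to the
   horizon; the indices J_{t+k}, ..., J_t are drawn as the recursion unwinds, J_t
   depending on the later draws through X_{t+1}^{(J_{t+1})} = thead path. *)
Fixpoint run k t (s : cloud) (x : nat -> X) : giry (k.+1.-tuple X) R :=
  if k is k'.+1 then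
    bind (step t s (x t.+1)) (fun s' =>
    bind (run k' t.+1 s' x) (fun path =>
    bind (categ (back_weight t s (thead path))) (fun j =>
    giry_ret (cons_tuple (tnth s j).2 path))))
  else
    bind (categ (fun i => potential m t (tnth s i))) (fun j =>
    giry_ret [tuple (tnth s j).2]).

Definition cbpf (x : T.+1.-tuple X) : giry (T.+1.-tuple X) R :=
  bind (init (coord x 1%N)) (fun s => run T 1%N s (coord x)).

End cbpf.
End model.

Section bind_lemmas.
Context d1 d2 (A : measurableType d1) (B : measurableType d2) (R : realType).

Lemma bindE (m : giry A R) (f : A -> giry B R) U :
  measurable_fun [set: A] f -> measurable U ->
  bind m f U = \int[m]_a f a U.
Proof.
move=> mf mU; rewrite /bind; case: pselect => // mf'.
rewrite /giry_bind /= /giry_join/=.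
have := giry_int_map mf' m (measurable_giry_ev mU) (fun x => measure_ge0 x U).
by [].
Qed.

Lemma bind_setT (m : giry A R) (f : A -> giry B R) :
  measurable_fun [set: A] f -> m [set: A] = 1 ->
  (forall a, f a [set: B] = 1) -> bind m f [set: B] = 1.
Proof.
move=> mf m1 f1; rewrite bindE//; under eq_integral do rewrite f1.
by rewrite integral_cst// mul1e; exact: m1.
Qed.

End bind_lemmas.

Lemma measurable_bind d0 d1 d2 (E : measurableType d0) (A : measurableType d1)
    (B : measurableType d2) (R : realType)
    (m : E -> giry A R) (f : E -> A -> giry B R) :
  measurable_fun [set: E] m ->
  measurable_fun [set: E * A] (fun z => f z.1 z.2) ->
  measurable_fun [set: E] (fun e => bind (m e) (f e)).
Proof.
move=> mm mf.
have mfe e : measurable_fun [set: A] (f e).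
  exact: (measurable_fun_pair2 e mf).
apply: measurable_giry_codensity => // U mU.
pose g e : giry (E * A)%type R := giry_prod (giry_ret e, m e).
have mg : measurable_fun [set: E] g.
  apply: (measurableT_comp measurable_giry_prod).
  by apply: measurable_fun_pair => //; exact: measurable_giry_ret.
have mfU : measurable_fun [set: E * A] (fun z => f z.1 z.2 U).
  exact: (measurableT_comp (measurable_giry_ev mU) mf).
apply: (eq_measurable_fun (fun e => giry_int (g e) (fun z => f z.1 z.2 U))).
  move=> e _; rewrite bindE// /g giry_int_prod1// giry_int_ret//=.
  exact: (@measurable_fun_fubini_tonelli_F _ _ _ _ _ (m e) _ mfU).
exact: (measurableT_comp (measurable_giry_int mfU (fun=> measure_ge0 _ _)) mg).
Qed.

Section draw_lemmas.
Context d0 d (E : measurableType d0) (X : measurableType d) (R : realType).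

Lemma drawE (mu : {measure set X -> \bar R}) (p : X -> R) U :
  is_density mu p -> draw mu p U = \int[mu]_(x in U) (p x)%:E.
Proof. by move=> hp; rewrite /draw; case: pselect. Qed.

Lemma draw_setT (mu : {measure set X -> \bar R}) (p : X -> R) :
  is_density mu p -> draw mu p [set: X] = 1.
Proof. by move=> hp; rewrite drawE//; case: hp. Qed.

Lemma measurable_draw (mu : {sigma_finite_measure set X -> \bar R})
    (p : E -> X -> R) :
  measurable_fun [set: E * X] (fun z => p z.1 z.2) ->
  (forall e, is_density mu (p e)) ->
  measurable_fun [set: E] (fun e => draw mu (p e)).
Proof.
move=> mp hp; apply: measurable_giry_codensity => // U mU.
have p0 e x : (0 <= p e x)%R by have [] := hp e.
pose h (z : E * X) := (p z.1 z.2 * \1_U z.2)%:E.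
have mh : measurable_fun [set: E * X] h.
  apply/measurable_EFinP; apply: measurable_funM => //.
  exact: (measurableT_comp (measurable_indic mU)).
have h0 z : 0 <= h z by rewrite lee_fin mulr_ge0.
apply: (eq_measurable_fun (fubini_F mu h)).
  move=> e _; rewrite drawE// /fubini_F/= [RHS]integral_mkcond.
  under [RHS]eq_integral do rewrite epatch_indic.
  by under [LHS]eq_integral do rewrite /h/= EFinM.
exact: measurable_fun_fubini_tonelli_F.
Qed.

End draw_lemmas.

Section categ_lemmas.
Context (R : realType) (n : nat).
Implicit Types (p w : 'I_n.+1 -> R).

Lemma counting_ordE (U : set 'I_n.+1) :
  counting U = msum (fun k => @dirac _ 'I_n.+1 (inord k) R) n.+1 U.
Proof.
rewrite /counting asboolT//; last exact: finite_finset.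
rewrite /msum card_fset_sum1 natr_sum -sumEFin.
have -> : \sum_(k < n.+1) \d_(inord k : 'I_n.+1) U =
          \sum_(k <- enum 'I_n.+1 | k \in U) 1%:E :> \bar R.
  rewrite big_enum_cond/= [RHS]big_mkcond; apply: eq_bigr => k _.
  by rewrite inord_val diracE; case: (k \in U).
rewrite -[RHS]big_filter; apply: perm_big; apply: uniq_perm => //;
  first by rewrite filter_uniq// enum_uniq.
move=> k; rewrite mem_filter mem_enum/= andbT in_fset_set; last exact: finite_finset.
by [].
Qed.

Lemma integral_counting_ord (f : 'I_n.+1 -> \bar R) : (forall i, 0 <= f i) ->
  \int[counting]_i f i = \sum_(i < n.+1) f i.
Proof.
move=> f0.
rewrite (eq_measure_integral
  (msum (fun k => @dirac _ 'I_n.+1 (inord k) R) n.+1)); last first.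
  by move=> A _ _; exact: counting_ordE.
rewrite ge0_integral_measure_sum//; apply: eq_bigr => i _.
by rewrite integral_dirac// diracT mul1e inord_val.
Qed.

Lemma is_density_counting p : is_density counting p <->
  (forall i, 0 <= p i)%R /\ (\sum_(i < n.+1) p i = 1)%R.
Proof.
have E : (forall i, 0 <= p i)%R ->
    \int[counting]_i (p i)%:E = (\sum_(i < n.+1) p i)%:E.
  by move=> p0; rewrite integral_counting_ord// ?sumEFin// => i; rewrite lee_fin.
split=> [[_ p0]|[p0 p1]].
  by rewrite E// => -[].
by split => //; rewrite E// p1.
Qed.

Lemma draw_countingE p U : is_density counting p ->
  draw counting p U = (\sum_(i < n.+1) p i * \1_U i)%:E.
Proof.
move=> hp; rewrite drawE//; case: hp => _ p0 _.
rewrite integral_mkcond; under eq_integral do rewrite epatch_indic.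
rewrite integral_counting_ord -?sumEFin//.
by move=> i; rewrite mule_ge0// lee_fin.
Qed.

Lemma categ_setT w : (forall i, 0 < w i)%R -> categ w [set: 'I_n.+1] = 1.
Proof.
move=> w0.
have S0 : (0 < \sum_j w j)%R.
  by rewrite big_ord_recl ltr_wpDr// sumr_ge0// => i _; exact/ltW.
apply: draw_setT; apply/is_density_counting; split.
  by move=> i; rewrite divr_ge0// ltW.
by rewrite -mulr_suml divff// gt_eqF.
Qed.

End categ_lemmas.

Lemma measurable_inv (R : realType) : measurable_fun [set: R] (fun x => x^-1)%R.
Proof.
rewrite (_ : (fun _ => _) = fun x => if x == 0%R then 0%R else x^-1%R); last first.
  by apply/funext => x; case: eqVneq => // ->; rewrite invr0.
apply: measurable_fun_if => //.
  exact: measurable_fun_eqr.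
rewrite setTI (_ : _ @^-1` _ = [set x | x != 0%R]); last first.
  by apply/seteqP; split => x /=; case: eqP.
apply: open_continuous_measurable_fun; first exact: open_neq.
by apply/in_setP => x /= x0; exact: inv_continuous.
Qed.

Lemma measurable_categ d (E : measurableType d) (R : realType) (n : nat)
    (w : E -> 'I_n.+1 -> R) :
  (forall i, measurable_fun [set: E] (fun e => w e i)) ->
  measurable_fun [set: E] (fun e => categ (w e)).
Proof.
move=> mw; pose p e i := (w e i / \sum_j w e j)%R.
have mp i : measurable_fun [set: E] (fun e => p e i).
  apply: measurable_funM => //; apply: (measurableT_comp (@measurable_inv R)).
  exact: measurable_sum.
apply: measurable_giry_codensity => // U _.
pose b e := all (fun i => 0 <= p e i)%R (enum 'I_n.+1) && (\sum_i p e i == 1)%R.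
have bP e : reflect (is_density counting (p e)) (b e).
  apply: (iffP andP) => [[/allP h /eqP h1]|/is_density_counting[h h1]].
    by apply/is_density_counting; split => // i; apply: h; rewrite mem_enum.
  by split; [apply/allP => i _|exact/eqP].
have mb : measurable_fun [set: E] b.
  apply: measurable_and; last first.
    by apply: measurable_fun_eqr => //; exact: measurable_sum.
  elim: (enum 'I_n.+1) => [|i s ih] //=.
  by apply: measurable_and => //; exact: measurable_fun_ler.
apply: (eq_measurable_fun (fun e => if b e then
    (\sum_(i < n.+1) p e i * \1_U i)%:E else 0)).
  move=> e _; case: bP => h; first by rewrite /categ draw_countingE.
  by rewrite /categ /draw; case: pselect.
apply: measurable_fun_ifT => //; apply/measurable_EFinP.
by apply: measurable_sum => i; exact: measurable_funM.
Qed.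

Lemma measurable_ord_pair d1 d2 (E : measurableType d1) (B : measurableType d2)
    n (f : E * 'I_n.+1 -> B) :
  (forall i, measurable_fun [set: E] (fun e => f (e, i))) ->
  measurable_fun [set: E * 'I_n.+1] f.
Proof.
move=> mf _ U mU; rewrite setTI (_ : _ @^-1` U =
    \bigcup_(i in [set: 'I_n.+1]) (((fun e => f (e, i)) @^-1` U) `*` [set i])).
  apply: fin_bigcup_measurable; first exact: finite_finset.
  move=> i _; apply: measurableX => //.
  by rewrite -[X in measurable X]setTI; exact: mf.
apply/seteqP; split => [[e i] /= Uf|[e i] [j _ [/= Uf ->]]]//.
by exists i.
Qed.

Lemma measurable_iid d0 d (E : measurableType d0) (A : measurableType d)
    (R : realType) n (m : E -> giry A R) :
  measurable_fun [set: E] m -> measurable_fun [set: E] (fun e => iid n (m e)).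
Proof.
move=> mm; elim: n => [|n ih] /=; first exact: measurable_cst.
apply: measurable_bind => //; apply: measurable_bind.
  exact: (measurableT_comp ih).
apply: (measurableT_comp measurable_giry_ret).
by apply: measurable_cons => //; exact: (measurableT_comp measurable_snd).
Qed.

Lemma iid_setT d (A : measurableType d) (R : realType) n (m : giry A R) :
  m [set: A] = 1 -> iid n m [set: n.-tuple A] = 1.
Proof.
move=> m1; elim: n => [|n ih] /=; first exact: diracT.
have mr (a : A) : measurable_fun setT
    (fun s : n.-tuple A => @giry_ret _ _ R (cons_tuple a s)).
  by apply: (measurableT_comp measurable_giry_ret); exact: measurable_cons.
apply: bind_setT => // [|a].
  apply: measurable_bind; first exact: measurable_cst.
  by apply: (measurableT_comp measurable_giry_ret); exact: measurable_cons.
by apply: bind_setT => // s; exact: diracT.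
Qed.

Section measurable_cbpf.
Context d (X : measurableType d) (R : realType).
Variable mu : {sigma_finite_measure set X -> \bar R}.
Context T (m : model mu T.+1) (n : nat).
Local Notation cloud := (n.+1.-tuple (X * X)%type).

Lemma measurable_val i : measurable_fun [set: cloud] (fun s => (tnth s i).2).
Proof. exact: (measurableT_comp measurable_snd (measurable_tnth i)). Qed.

Lemma measurable_MG t d0 (E : measurableType d0) (f g : E -> X) :
  (2 <= t <= T.+1)%N ->
  measurable_fun [set: E] f -> measurable_fun [set: E] g ->
  measurable_fun [set: E] (fun e => M m t (f e) (g e)) /\
  measurable_fun [set: E] (fun e => G m t (f e) (g e)).
Proof.
move=> tT mf mg; have mfg := measurable_fun_pair mf mg; split.
  exact: (measurableT_comp (M_measurable m tT) mfg).
exact: (measurableT_comp (G_measurable m tT) mfg).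
Qed.

Lemma measurable_potential t : (1 <= t <= T.+1)%N ->
  measurable_fun [set: X * X] (potential m t).
Proof.
rewrite /potential; case: eqVneq => [_ _|t1 /andP[t0 tT]].
  exact: (measurableT_comp (G1_measurable m)).
by apply: G_measurable; rewrite tT ltn_neqAle eq_sym t1 t0.
Qed.

Lemma measurable_weight t i : (1 <= t <= T.+1)%N ->
  measurable_fun [set: cloud] (fun s => potential m t (tnth s i)).
Proof.
by move=> tT; exact: (measurableT_comp (measurable_potential tT) (measurable_tnth i)).
Qed.

Lemma measurable_init : measurable_fun [set: X] (init m n).
Proof.
rewrite /init; apply: measurable_bind; first exact: measurable_cst.
apply: (measurableT_comp measurable_giry_ret); apply: measurable_cons => //.
by apply: measurable_fun_pair => //; exact: measurable_fst.
Qed.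

Lemma measurable_propagate t : (1 <= t <= T)%N ->
  measurable_fun [set: cloud] (propagate m t).
Proof.
move=> /andP[t1 tT]; rewrite /propagate; apply: measurable_bind.
  by apply: measurable_categ => i; apply: measurable_weight; rewrite t1 leqW.
have tT' : (2 <= t.+1 <= T.+1)%N by rewrite !ltnS t1.
apply: measurable_ord_pair => i /=; apply: measurable_bind.
  apply: measurable_draw; last by move=> s; exact: M_density.
  apply: (measurable_MG tT' _ _).1 => //.
  exact: (measurableT_comp (measurable_val i)).
apply: (measurableT_comp measurable_giry_ret).
apply: measurable_fun_pair => //.
exact: (measurableT_comp (measurable_val i)).
Qed.

Lemma measurable_step t : (1 <= t <= T)%N ->
  measurable_fun [set: cloud * X] (fun z => step m t z.1 z.2).
Proof.
move=> tT; rewrite /step; apply: measurable_bind.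
  apply: measurable_iid.
  exact: (measurableT_comp (measurable_propagate tT) measurable_fst).
apply: (measurableT_comp measurable_giry_ret); apply: measurable_cons => //.
apply: measurable_fun_pair.
  apply: (measurableT_comp (measurable_val ord0)).
  exact: (measurableT_comp measurable_fst).
exact: (measurableT_comp measurable_snd).
Qed.

Lemma measurable_run k t d0 (E : measurableType d0)
    (s : E -> cloud) (x : E -> nat -> X) :
  (1 <= t)%N -> (t + k <= T.+1)%N ->
  measurable_fun [set: E] s ->
  (forall t, measurable_fun [set: E] (fun e => x e t)) ->
  measurable_fun [set: E] (fun e => run m k t (s e) (x e)).
Proof.
elim: k t d0 E s x => [|k ih] t d0 E s x t1 tk ms mx /=.
  have tT : (1 <= t <= T.+1)%N by rewrite t1 -(addn0 t).
  apply: measurable_bind.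
    apply: measurable_categ => i.
    exact: (measurableT_comp (measurable_weight i tT)).
  apply: measurable_ord_pair => i /=.
  apply: (measurableT_comp measurable_giry_ret).
  apply: measurable_cons; last exact: measurable_cst.
  exact: (measurableT_comp (measurable_val i)).
have tT : (1 <= t <= T)%N.
  by rewrite t1 -ltnS (leq_trans _ tk)// addnS ltnS leq_addr.
have tT0 : (1 <= t <= T.+1)%N by case/andP: tT => -> /leqW ->.
have tT1 : (2 <= t.+1 <= T.+1)%N by rewrite !ltnS.
have msx := measurable_fun_pair ms (mx t.+1).
have mst := measurableT_comp (measurable_step tT) msx.
apply: measurable_bind; first exact: mst.
apply: measurable_bind.
  apply: ih => //; first by rewrite addSnnS.
  by move=> t'; exact: (measurableT_comp (mx t')).
pose pv i (z : (E * cloud) * (k.+1.-tuple X)) := (tnth (s z.1.1) i).2.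
have msz : measurable_fun setT (fun z : (E * cloud) * k.+1.-tuple X => s z.1.1).
  by apply: (measurableT_comp ms); exact: (measurableT_comp measurable_fst).
have mth : measurable_fun setT (fun z : (E * cloud) * k.+1.-tuple X => thead z.2).
  exact: (measurableT_comp (measurable_tnth ord0)).
have mv i : measurable_fun setT (pv i).
  exact: (measurableT_comp (measurable_val i)).
apply: measurable_bind.
  apply: measurable_categ => i; apply: measurable_funM; last first.
    exact: (measurable_MG tT1 (mv i) mth).2.
  apply: measurable_funM.
    exact: (measurableT_comp (measurable_weight i tT0)).
  exact: (measurable_MG tT1 (mv i) mth).1.
apply: measurable_ord_pair => i /=.
apply: (measurableT_comp measurable_giry_ret).
by apply: measurable_cons => //; exact: mv.
Qed.

Lemma measurable_coord k t : measurable_fun [set: k.-tuple X] (fun x => coord x t).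
Proof.
rewrite /coord; have [tk|tk] := ltnP t.-1 k.
  rewrite (_ : (fun _ => _) = fun x => tnth x (Ordinal tk)).
    exact: measurable_tnth.
  by apply/funext => x; rewrite (tnth_nth point).
rewrite (_ : (fun _ => _) = cst point); first exact: measurable_cst.
by apply/funext => x; rewrite nth_default// size_tuple.
Qed.

Lemma measurable_cbpf : measurable_fun [set: T.+1.-tuple X] (cbpf m n).
Proof.
rewrite /cbpf; apply: measurable_bind.
  exact: (measurableT_comp measurable_init (@measurable_coord _ 1%N)).
apply: measurable_run => // t.
exact: (measurableT_comp (@measurable_coord _ t)).
Qed.

Section mass.
Hypothesis hm : strong_mixing m.

Lemma potential_gt0 t z : (1 <= t <= T.+1)%N -> (0 < potential m t z)%R.
Proof.
move=> tT; have [+ _] := hm.1 t tT; rewrite /G_inf /potential -lte_fin.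
by case: ifP => _ /lt_le_trans; apply; apply: ereal_inf_lbound;
  [exists z.2|exists z].
Qed.

Lemma M_gt0 t x y : (2 <= t <= T.+1)%N -> (0 < M m t x y)%R.
Proof.
move=> tT; have [+ _] := hm.2 t tT; rewrite /M_inf -lte_fin => /lt_le_trans.
by apply; apply: ereal_inf_lbound; exists (x, y).
Qed.

Lemma init_setT x : init m n x [set: cloud] = 1.
Proof.
apply: bind_setT => [||s]; last exact: diracT.
  by apply: (measurableT_comp measurable_giry_ret); exact: measurable_cons.
apply: iid_setT; apply: bind_setT => [||y]; last exact: diracT.
  by apply: (measurableT_comp measurable_giry_ret); exact: measurable_fun_pair.
exact: draw_setT (M1_density m).
Qed.

Lemma step_setT t (s : cloud) x : (1 <= t <= T)%N -> step m t s x [set: cloud] = 1.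
Proof.
move=> /andP[t1 tT]; have tT' : (2 <= t.+1 <= T.+1)%N by rewrite !ltnS t1.
have mM y : measurable_fun [set: X] (fun z => @giry_ret _ _ R (y, z) : giry (X * X)%type R).
  by apply: (measurableT_comp measurable_giry_ret); exact: measurable_fun_pair.
apply: bind_setT => [||s']; last exact: diracT.
  by apply: (measurableT_comp measurable_giry_ret); exact: measurable_cons.
apply: iid_setT; apply: bind_setT => // [|a].
  by apply: categ_setT => i; apply: potential_gt0; rewrite t1 leqW.
apply: bind_setT => // [|y]; last exact: diracT.
exact: draw_setT (M_density _ tT' _).
Qed.

Lemma run_setT k t (s : cloud) x : (1 <= t)%N -> (t + k <= T.+1)%N ->
  run m k t s x [set: k.+1.-tuple X] = 1.
Proof.
elim: k t s => [|k ih] t s t1 tk /=.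
  have tT : (1 <= t <= T.+1)%N by rewrite t1 -(addn0 t).
  apply: bind_setT => // [|j]; last exact: diracT.
  by apply: categ_setT => i; exact: potential_gt0.
have tT : (1 <= t <= T)%N.
  by rewrite t1 -ltnS (leq_trans _ tk)// addnS ltnS leq_addr.
have tT0 : (1 <= t <= T.+1)%N by case/andP: tT => -> /leqW ->.
have tT1 : (2 <= t.+1 <= T.+1)%N by rewrite !ltnS.
have mj (E := k.+1.-tuple X) : measurable_fun [set: E] (fun path =>
    bind (categ (back_weight m t s (thead path)))
      (fun j => @giry_ret _ _ R (cons_tuple (tnth s j).2 path))).
  have mth : measurable_fun setT (@thead k X) := measurable_tnth ord0.
  apply: measurable_bind.
    apply: measurable_categ => i; apply: measurable_funM; last first.
      exact: (measurable_MG tT1 (measurable_cst _) mth).2.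
    by apply: measurable_funM => //; exact: (measurable_MG tT1 (measurable_cst _) mth).1.
  apply: measurable_ord_pair => i /=.
  by apply: (measurableT_comp measurable_giry_ret); exact: measurable_cons.
apply: bind_setT => [||s']; last 1 first.
- apply: bind_setT => // [|path]; first by apply: ih; rewrite // addSnnS.
  apply: bind_setT => // [|j]; last exact: diracT.
  apply: categ_setT => i; rewrite /back_weight !mulr_gt0 ?M_gt0 ?potential_gt0//.
  have := @potential_gt0 t.+1 ((tnth s i).2, thead path).
  by rewrite /potential eqSS gtn_eqF//; apply; case/andP: tT1.
- apply: measurable_bind; last exact: (measurableT_comp mj).
  by apply: measurable_run => //; rewrite addSnnS.
- exact: step_setT.
Qed.

Lemma cbpf_setT x : cbpf m n x [set: T.+1.-tuple X] = 1.
Proof.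
apply: bind_setT => [||s]; [|exact: init_setT|exact: run_setT].
by apply: measurable_run => // t; exact: measurable_cst.
Qed.

End mass.

Definition cbpf_kernel (x : T.+1.-tuple X) :
  {measure set (T.+1.-tuple X) -> \bar R} := cbpf m n x.

Let measurable_cbpf_kernel (U : set (T.+1.-tuple X)) : measurable U ->
  measurable_fun [set: T.+1.-tuple X] (cbpf_kernel ^~ U).
Proof.
by move=> mU; exact: (measurableT_comp (measurable_giry_ev mU) measurable_cbpf).
Qed.

HB.instance Definition _ :=
  isKernel.Build _ _ _ _ R cbpf_kernel measurable_cbpf_kernel.

Let cbpf_kernel_le1 :
  ereal_sup [set cbpf_kernel x [set: _] | x in [set: _]] <= 1.
Proof.
apply: ge_ereal_sup => _ [x _ <-].
exact: (@sprobability_setT _ _ _ (cbpf m n x)).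
Qed.

HB.instance Definition _ :=
  Kernel_isSubProbability.Build _ _ _ _ R cbpf_kernel cbpf_kernel_le1.

End measurable_cbpf.


Section target_lemmas.
Context d (X : measurableType d) (R : realType).
Variable mu : {sigma_finite_measure set X -> \bar R}.
Context T (m : model mu T).

Lemma measurable_gamma : measurable_fun [set: T.-tuple X] (@gamma _ _ _ _ _ m).
Proof.
have mG1 := measurableT_comp (G1_measurable m) (@measurable_coord _ X T 1%N).
have [mM1 _ _] := M1_density m.
have mM1' := measurableT_comp mM1 (@measurable_coord _ X T 1%N).
apply: measurable_funM; first exact: measurable_funM.
apply: measurable_prod => t; rewrite mem_index_iota ltnS => tT.
have mcc := measurable_fun_pair (@measurable_coord _ X T t.-1) (@measurable_coord _ X T t).
apply: measurable_funM.
  exact: (measurableT_comp (M_measurable m tT) mcc).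
exact: (measurableT_comp (G_measurable m tT) mcc).
Qed.

Lemma gamma_ge0 x : (0 <= gamma m x)%R.
Proof.
have [_ M10 _] := M1_density m.
rewrite /gamma /path_weight mulr_ge0 ?mulr_ge0 ?G1_ge0//.
rewrite big_nat; apply: prodr_ge0 => t; rewrite ltnS => tT.
by rewrite mulr_ge0 ?G_ge0//; case: (M_density m tT (coord x t.-1)).
Qed.

Lemma target_density :
  is_density (tuple_measure mu T) (fun x => gamma m x / fine (normc m))%R.
Proof.
have c0 : (0 < fine (normc m))%R by rewrite fine_gt0// normc_gt0 normc_lty.
split.
- by apply: measurable_funM => //; exact: measurable_gamma.
- by move=> x; rewrite divr_ge0 ?gamma_ge0// ltW.
- under eq_integral do rewrite mulrC EFinM.
  rewrite ge0_integralZl//.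
  + rewrite -[X in _ * X](@fineK _ (normc m)).
      by rewrite -EFinM mulVf// gt_eqF.
    by rewrite gt0_fin_numE ?normc_gt0 ?normc_lty.
  + by apply/measurable_EFinP; exact: measurable_gamma.
  + by move=> x _; rewrite lee_fin gamma_ge0.
  + by rewrite lee_fin invr_ge0 ltW.
Qed.

End target_lemmas.

Fixpoint kpow d (Y : measurableType d) (R : realType) (P : R.-spker Y ~> Y)
    (k : nat) : R.-spker Y ~> Y :=
  if k is k'.+1 then mkcomp_noparam P (kpow P k')
  else kdirac (@measurable_id _ Y [set: Y]).

Definition tv d (Y : measurableType d) (R : realType)
    (m1 m2 : {measure set Y -> \bar R}) : \bar R :=
  ereal_sup [set `|\int[m1]_y (f y)%:E - \int[m2]_y (f y)%:E|
            | f in [set f : Y -> R | measurable_fun [set: Y] f /\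
                                     forall y, (`|f y| <= 1)%R]].

(* sup_x || P_{T.+1,N}^k(x, .) - pi_{T.+1} ||_tv; [cbpf_kernel] is parametrized by
   the number N.-1 of particles other than the reference. *)
Definition sup_tv d (X : measurableType d) (R : realType)
    (mu : {sigma_finite_measure set X -> \bar R}) (T : nat) (m : model mu T.+1)
    (N k : nat) : \bar R :=
  ereal_sup (range (fun x => tv (kpow (cbpf_kernel m N.-1) k x) (target m))).

Definition tv_vanishes (R : realType) (eps rho : R) (N : nat) : Prop :=
  forall (d : measure_display) (X : measurableType d)
    (mu : {sigma_finite_measure set X -> \bar R})
    (m : forall T, model mu T.+1),
    (forall T, strong_mixing (m T) /\ (eps <= mixing_eps (m T))%R) ->
    (fun T => sup_tv (m T) N `|Num.ceil (rho * T.+1%:R)|%N) @ \oo --> 0.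

(* Main.v *)
(* Backward sampling makes the influence of x_{t+1} on x_t contract: two backward
   steps started from different points select the same particle with probability
   at least eps. Give pairs of paths that agree up to time j exactly the distance
   alpha^(T - j). A test function that is 1-Lipschitz for it is mapped by the kernel
   to a function with a Lipschitz constant as small as desired, if N is large.
   Indeed, when the references agree up to time j, the particle systems agree up to
   time j, and looking only r steps beyond (the error of this truncation is of order
   alpha^-r by the contraction of backward sampling), a change of the references
   amounts to boundedly many changes of a single one out of N exchangeable
   particles, each costing O(1/N). No uniform-in-time stability of the forward
   filter is needed, as r is chosen before N. Invariance of the target, proved by
   backward induction on the time with exchangeability of the particles, turns the
   contraction into convergence; the loss of constants is absorbed in beta. *)
Require Import Defs.
From mathcomp Require Import all_boot all_order all_algebra.
From mathcomp Require Import all_classical all_reals all_analysis.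
From mathcomp Require Import measurable_realfun giry ring lra zify.
Import Order.TTheory GRing.Theory Num.Theory.
Import numFieldNormedType.Exports.
Local Open Scope classical_set_scope.
Local Open Scope ring_scope.

Set Implicit Arguments.
Unset Strict Implicit.
Unset Printing Implicit Defensive.

(** * Expectations of [0,1]-valued functions *)

(** No coupling is constructed: couplings are replaced by bounds on how much [0,1]-valued functions
    vary. The weights of J_t depend only on the cloud at time t and on the later path, so an
    expectation under [run] can be computed by pulling the function through the backward step at
    time t before the next cloud is drawn ([back], [lookahead]). The obstacle is that this pull-back
    may spoil the Lipschitz bound for paths that differ from their first position on. A Doeblin
    minorisation keeps the class [osc_le] stable, at the price of a constant K for such pairs and of
    the condition (1 - eps) alpha < 1. The condition is harmless, since decreasing alpha only
    strengthens the final estimate. Distances between paths lie between 1 and alpha^T: the lower end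
    makes every [0,1]-valued function Lipschitz with constant 1, the upper end turns a Lipschitz
    constant beta^-k into the bound alpha^T beta^-k. *)

Definition test d (A : measurableType d) (R : realType) (f : A -> R) : Prop :=
  measurable_fun [set: A] f /\ forall a, 0 <= f a <= 1.

(** Real-valued, so that differences of expectations can be estimated in R; [fine] loses nothing for
    [test] functions and mass at most 1, see [ExE]. *)
Definition Ex d (A : measurableType d) (R : realType)
    (m : {measure set A -> \bar R}) (f : A -> R) : R :=
  fine (\int[m]_a (f a)%:E).

Section expectation.
Context d (A : measurableType d) (R : realType).
Implicit Types (m : {measure set A -> \bar R}) (f g : A -> R).

Lemma test_integrable m f : (m [set: A] <= 1)%E -> test f ->
  m.-integrable [set: A] (EFin \o f).
Proof.
move=> m1 [mf f01]; apply/integrableP; split; first exact/measurable_EFinP.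
apply: (@le_lt_trans _ _ (\int[m]_a (cst 1%E a))%E).
  apply: ge0_le_integral => //.
    by apply/measurable_EFinP; exact: measurableT_comp.
  move=> a _; rewrite lee_fin ger0_norm; by case/andP: (f01 a).
by rewrite integral_cst// mul1e (le_lt_trans m1)// ltry.
Qed.

Lemma ExE m f : (m [set: A] <= 1)%E -> test f ->
  (Ex m f)%:E = (\int[m]_a (f a)%:E)%E.
Proof.
move=> m1 tf; rewrite fineK//.
exact: (integrable_fin_num measurableT (test_integrable m1 tf)).
Qed.

Lemma Ex_itv m f : (m [set: A] <= 1)%E -> test f -> 0 <= Ex m f <= 1.
Proof.
move=> m1 tf; have [mf f01] := tf; rewrite -!lee_fin ExE//; apply/andP; split.
  by apply: integral_ge0 => a _; rewrite lee_fin; case/andP: (f01 a).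
apply: (@le_trans _ _ (\int[m]_a (cst 1%E a))%E).
  apply: ge0_le_integral => //.
  - by move=> a _; rewrite lee_fin; case/andP: (f01 a).
  - exact/measurable_EFinP.
  - by move=> a _; rewrite lee_fin; case/andP: (f01 a).
by rewrite integral_cst// mul1e.
Qed.

Lemma Ex_dist m f g c : (m [set: A] <= 1)%E -> test f -> test g ->
  (forall a, `|f a - g a| <= c) -> 0 <= c -> `|Ex m f - Ex m g| <= c.
Proof.
move=> m1 tf tg fg c0.
have iF := test_integrable m1 tf; have iG := test_integrable m1 tg.
rewrite /Ex -fineB ?integrable_fin_num// -integralB//.
apply: (@le_trans _ _ (fine (\int[m]_a (cst c%:E a))%E)); last first.
  rewrite integral_cst//.
  have mf : m [set: A] \is a fin_num by rewrite ge0_fin_numE// (le_lt_trans m1)// ltry.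
  by rewrite fineM//= ler_piMr// -lee_fin fineK.
have ci : m.-integrable [set: A] (cst c%:E).
  apply/integrableP; split => //; under eq_integral do rewrite /= ger0_norm//.
  rewrite (integral_cst m measurableT c%:E) (le_lt_trans _ (ltry c))//.
  by rewrite -[leRHS]mule1 lee_pmul.
rewrite -fine_abse; last by rewrite integrable_fin_num//; exact: integrableB.
apply: fine_le.
- by rewrite abse_fin_num integrable_fin_num//; exact: integrableB.
- exact: (integrable_fin_num measurableT ci).
apply: (le_trans (le_abse_integral _ _ _)) => //.
  by apply: emeasurable_funB; [case/integrableP: iF|case/integrableP: iG].
apply: ge0_le_integral => //.
- apply: measurableT_comp => //.
  by apply: emeasurable_funB; [case/integrableP: iF|case/integrableP: iG].
- by move=> a _; rewrite /= lee_fin; exact: fg.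
Qed.

Lemma eq_Ex m f g : f =1 g -> Ex m f = Ex m g.
Proof. by move=> fg; congr (fine _); apply: eq_integral => a _; rewrite fg. Qed.

Lemma Ex_cst m c : m [set: A] = 1%E -> Ex m (fun=> c) = c.
Proof. by move=> m1; rewrite /Ex integral_cst// m1 mule1. Qed.

Lemma Ex_dev m f a c : m [set: A] = 1%E -> test f ->
  (forall x, `|f x - a| <= c) -> 0 <= a <= 1 -> `|Ex m f - a| <= c.
Proof.
move=> m1 tf fa a01; rewrite -[a in X in X <= _](Ex_cst a m1).
apply: Ex_dist => //; first by rewrite m1.
by apply: le_trans (fa point); exact: normr_ge0.
Qed.

End expectation.

(** No joint law of the two variables is needed: one of them is averaged at a time, by [Ex_dev]. *)
Lemma Ex_dev2 d1 d2 (A : measurableType d1) (B : measurableType d2)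
    (R : realType) (m : {measure set A -> \bar R}) (m' : {measure set B -> \bar R})
    (f : A -> R) (g : B -> R) c :
  m [set: A] = 1%E -> m' [set: B] = 1%E -> test f -> test g ->
  (forall a b, `|f a - g b| <= c) -> `|Ex m f - Ex m' g| <= c.
Proof.
move=> m1 m'1 tf tg fg; rewrite distrC; apply: Ex_dev => //.
  by move=> b; rewrite distrC; apply: Ex_dev => //; case: tg.
by apply: Ex_itv => //; rewrite m1.
Qed.

Section giry_expectation.
Context d1 d2 (A : measurableType d1) (B : measurableType d2) (R : realType).

Lemma integral_bind (m : giry A R) (k : A -> giry B R) (f : B -> \bar R) :
  measurable_fun [set: A] k -> measurable_fun [set: B] f ->
  (forall b, 0 <= f b)%E ->
  (\int[bind m k]_b f b = \int[m]_a \int[k a]_b f b)%E.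
Proof.
move=> mk mf f0; rewrite /bind; case: pselect => // mk'.
exact: (giry_int_bind m mk' mf f0).
Qed.

Lemma Ex_bind (m : giry A R) (k : A -> giry B R) (f : B -> R) :
  measurable_fun [set: A] k -> test f ->
  Ex (bind m k) f = Ex m (fun a => Ex (k a) f).
Proof.
move=> mk tf; have [mf f01] := tf; rewrite /Ex integral_bind//.
- by congr fine; apply: eq_integral => a _; rewrite -ExE//; exact: sprobability_setT.
- exact/measurable_EFinP.
- by move=> b; rewrite lee_fin; case/andP: (f01 b).
Qed.

Lemma integral_ret (a : A) (f : A -> \bar R) : measurable_fun [set: A] f ->
  (\int[@giry_ret _ _ R a]_x f x = f a)%E.
Proof. exact: giry_int_ret. Qed.

Lemma Ex_ret (a : A) (f : A -> R) : test f -> Ex (@giry_ret _ _ R a) f = f a.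
Proof. by move=> [mf _]; rewrite /Ex integral_ret//; exact/measurable_EFinP. Qed.

Lemma measurable_integral (m : A -> giry B R) (f : A -> B -> \bar R) :
  measurable_fun [set: A] m ->
  measurable_fun [set: A * B] (fun z => f z.1 z.2) ->
  (forall a b, 0 <= f a b)%E ->
  measurable_fun [set: A] (fun a => \int[m a]_b f a b)%E.
Proof.
move=> mm mf f0; pose g a : giry (A * B)%type R := giry_prod (giry_ret a, m a).
have mg : measurable_fun [set: A] g.
  apply: (measurableT_comp measurable_giry_prod).
  by apply: measurable_fun_pair => //; exact: measurable_giry_ret.
apply: (eq_measurable_fun (fun a => giry_int (g a) (fun z => f z.1 z.2))).
  move=> a _; rewrite /g giry_int_prod1// giry_int_ret//=.
  exact: (@measurable_fun_fubini_tonelli_F _ _ _ _ _ (m a) _ mf).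
exact: (measurableT_comp (measurable_giry_int mf (fun=> f0 _ _)) mg).
Qed.

Lemma test_Ex (m : A -> giry B R) (f : A -> B -> R) :
  measurable_fun [set: A] m -> test (fun z : A * B => f z.1 z.2) ->
  test (fun a => Ex (m a) (f a)).
Proof.
move=> mm [mf f01]; have tf a : test (f a).
  by split => [|b]; [exact: (measurable_fun_pair2 a mf)|exact: (f01 (a, b))].
split=> [|a]; last by apply: Ex_itv => //; exact: sprobability_setT.
apply: (measurableT_comp (f := fine)) => //.
apply: measurable_integral => //; first exact/measurable_EFinP.
by move=> a b; rewrite lee_fin; case/andP: (f01 (a, b)).
Qed.

Lemma test_comp (f : B -> R) (h : A -> B) : test f ->
  measurable_fun [set: A] h -> test (f \o h).
Proof.
by move=> [mf f01] mh; split => [|a]; [exact: (measurableT_comp mf mh)|exact: f01].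
Qed.

End giry_expectation.

Section integral_draw.
Context d (A : measurableType d) (R : realType).
Variables (mu : {measure set A -> \bar R}) (p : A -> R).
Hypothesis hp : is_density mu p.

Import HBNNSimple.

(** The definition of [draw] gives the case of indicators; linearity extends it to simple functions,
    monotone convergence to all non-negative ones. *)
Lemma integral_draw (f : A -> \bar R) : measurable_fun [set: A] f ->
  (forall a, 0 <= f a)%E ->
  (\int[draw mu p]_a f a = \int[mu]_a ((p a)%:E * f a))%E.
Proof.
move=> mf f0; have [mp p0 _] := hp.
have mp' : measurable_fun [set: A] (EFin \o p) by exact/measurable_EFinP.
have dE U : (draw mu p : {measure set A -> \bar R}) U = (\int[mu]_(x in U) (p x)%:E)%E.
  exact: drawE.
have simple (h : {nnsfun A >-> R}) :
    (\int[draw mu p]_a (h a)%:E = \int[mu]_a ((p a)%:E * (h a)%:E))%E.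
  rewrite integralT_nnsfun sintegralE.
  transitivity (\int[mu]_a
      (\sum_(r \in range h) (p a)%:E * (r * \1_(h @^-1` [set r]) a)%:E))%E.
    rewrite ge0_integral_fsum//; last 2 first.
    - move=> r; apply: emeasurable_funM => //; apply/measurable_EFinP.
      exact: measurable_funM.
    - by move=> r a _; apply: mule_ge0; [rewrite lee_fin|rewrite EFinM nnfun_muleindic_ge0].
    apply: eq_fsbigr => r; rewrite inE => -[a _ <-].
    rewrite dE integral_mkcond -ge0_integralZl//.
    - by apply: eq_integral => x _; rewrite epatch_indic -!EFinM mulrCA.
    - rewrite -(measurable_restrictT _ _)//.
      exact: measurable_funTS.
    - by move=> x _; rewrite erestrict_ge0// => y _; rewrite lee_fin.
    - by rewrite lee_fin.
  apply: eq_integral => a _; rewrite fimfunE -fsumEFin//.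
  by rewrite ge0_mule_fsumr// => r; exact: nnfun_muleindic_ge0.
pose h := nnsfun_approx measurableT mf.
have hf a : (h n a)%:E @[n --> \oo] --> f a by exact: cvg_nnsfun_approx.
transitivity (limn (fun n => \int[draw mu p]_a (h n a)%:E))%E.
  rewrite -monotone_convergence//.
  - by apply: eq_integral => a _; exact/esym/cvg_lim.
  - by move=> n; exact/measurable_EFinP.
  - by move=> n a _; rewrite lee_fin.
  - by move=> a _ i j ij; rewrite lee_fin; exact/lefP/nd_nnsfun_approx.
under eq_fun do rewrite simple.
rewrite -monotone_convergence//.
- apply: eq_integral => a _; apply/cvg_lim => //.
  by apply: cvgeZl => //; exact: hf.
- by move=> n; apply: emeasurable_funM => //; exact/measurable_EFinP.
- by move=> n a _; rewrite mule_ge0 ?lee_fin.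
- move=> a _ i j ij; rewrite lee_pmul ?lee_fin//; exact/lefP/nd_nnsfun_approx.
Qed.

End integral_draw.

(** * Weighted averages *)

Section weighted_average.
Context (R : realType) (n : nat).
Implicit Types (w h : 'I_n.+1 -> R).

Definition wavg w h : R := (\sum_i w i * h i) / \sum_i w i.

Lemma sum_gt0 w : (forall i, 0 < w i) -> 0 < \sum_i w i.
Proof.
by move=> w0; rewrite big_ord_recl ltr_wpDr// sumr_ge0// => i _; exact: ltW.
Qed.

Lemma is_density_categ w : (forall i, 0 < w i) ->
  is_density counting (fun i => w i / \sum_j w j).
Proof.
move=> w0; have W0 := sum_gt0 w0; apply/is_density_counting; split.
  by move=> i; rewrite divr_ge0// ltW.
by rewrite -mulr_suml divff// gt_eqF.
Qed.

Lemma integral_categ w (h : 'I_n.+1 -> \bar R) : (forall i, 0 < w i) ->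
  (forall i, 0 <= h i)%E ->
  (\int[categ w]_i h i = \sum_i (w i / \sum_j w j)%:E * h i)%E.
Proof.
move=> w0 h0; rewrite integral_draw//; last exact: is_density_categ.
rewrite integral_counting_ord// => i; rewrite mule_ge0// lee_fin.
by rewrite divr_ge0// ltW// sum_gt0.
Qed.

Lemma Ex_categ w h : (forall i, 0 < w i) -> (forall i, 0 <= h i) ->
  Ex (categ w) h = wavg w h.
Proof.
move=> w0 h0; rewrite /Ex integral_categ//.
under eq_bigr do rewrite -EFinM.
by rewrite sumEFin/= /wavg mulr_suml; apply: eq_bigr => i _; rewrite mulrAC.
Qed.

Lemma wavg_itv w h a b : (forall i, 0 < w i) -> (forall i, a <= h i <= b) ->
  a <= wavg w h <= b.
Proof.
move=> w0 hab; rewrite ler_pdivlMr ?ler_pdivrMr ?sum_gt0// !mulr_sumr.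
by apply/andP; split; apply: ler_sum => i _; rewrite [w i * _]mulrC ler_pM2r//;
  case/andP: (hab i).
Qed.

Lemma wavg_dist w h h' c : (forall i, 0 < w i) ->
  (forall i, `|h i - h' i| <= c) -> `|wavg w h - wavg w h'| <= c.
Proof.
move=> w0 hh'; have -> : wavg w h - wavg w h' = wavg w (fun i => h i - h' i).
  rewrite /wavg -mulrBl -sumrB; congr (_ / _).
  by apply: eq_bigr => i _; rewrite mulrBr.
by rewrite ler_norml wavg_itv// => i; rewrite -ler_norml.
Qed.

Lemma wavg_dev w h a c : (forall i, 0 < w i) ->
  (forall i, `|h i - a| <= c) -> `|wavg w h - a| <= c.
Proof.
move=> w0 ha; rewrite distrC ler_distlC -ler_distl.
have : a - c <= wavg w h <= a + c by apply: wavg_itv => // i; rewrite -ler_distl.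
by rewrite -ler_distl.
Qed.

(** Let x, x' be the two averages and S the total weight of the unchanged indices. Their
    contributions cancel in (x - x') S = w_i0 (h_i0 - x) - w'_i0 (h'_i0 - x'). Both deviations are
    at most o, and S is at least n eps times either weight of i0, because each of the n other
    weights is at least eps times it. *)
Lemma wavg_change1 eps w w' h h' o i0 : 0 < eps -> (0 < n)%N ->
  (forall i, 0 < w i) -> (forall i, 0 < w' i) ->
  (forall i j, eps * w i <= w j) -> (forall i j, eps * w' i <= w' j) ->
  (forall i, i != i0 -> w i = w' i /\ h i = h' i) ->
  (forall i j, `|h i - h j| <= o) -> (forall i j, `|h' i - h' j| <= o) ->
  `|wavg w h - wavg w' h'| <= 2 / eps * o / n%:R.
Proof.
move=> e0 n0 w0 w'0 ww ww' off ho h'o.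
pose S := \sum_(i | i != i0) w i.
have o0 : 0 <= o by exact: le_trans (ho ord0 ord0).
have nS v : (forall i j, eps * v i <= v j) ->
    (forall i, i != i0 -> w i = v i) -> n%:R * (eps * v i0) <= S.
  move=> vv vE; rewrite /S (eq_bigr v)//.
  have -> : n%:R * (eps * v i0) = \sum_(i | i != i0) (eps * v i0).
    rewrite sumr_const mulr_natl; congr (_ *+ _).
    by rewrite (cardC1 i0) card_ord.
  exact: ler_sum.
have S1 := nS w ww (fun _ _ => erefl).
have S2 := nS w' ww' (fun i hi => (off i hi).1).
have W0 := sum_gt0 w0; have W'0 := sum_gt0 w'0.
have WE : \sum_i w i = w i0 + S by rewrite (bigD1 i0).
have W'E : \sum_i w' i = w' i0 + S.
  by rewrite (bigD1 i0)//; congr (_ + _); apply: eq_bigr => i /off[].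
have n0' : 0 < n%:R :> R by rewrite ltr0n.
have S0 : 0 < S by apply: lt_le_trans S1; rewrite !mulr_gt0.
set x := wavg w h; set x' := wavg w' h'.
have xE : x * (w i0 + S) = w i0 * h i0 + \sum_(i | i != i0) w i * h i.
  by rewrite -WE divfK ?gt_eqF// (bigD1 i0).
have x'E : x' * (w' i0 + S) = w' i0 * h' i0 + \sum_(i | i != i0) w i * h i.
  rewrite -W'E divfK ?gt_eqF// (bigD1 i0)//; congr (_ + _).
  by apply: eq_bigr => i /off[-> ->].
have hx : `|h i0 - x| <= o by rewrite distrC wavg_dev.
have hx' : `|h' i0 - x'| <= o by rewrite distrC wavg_dev.
have E : (x - x') * S = w i0 * (h i0 - x) - w' i0 * (h' i0 - x').
  by move: xE x'E; lra.
have E1 : `|x - x'| * S <= (w i0 + w' i0) * o.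
  rewrite -(gtr0_norm S0) -normrM E mulrDl (le_trans (ler_normB _ _))//.
  by rewrite !normrM (gtr0_norm (w0 _)) (gtr0_norm (w'0 _)) lerD// ler_pM2l.
rewrite -(ler_pM2r S0) (le_trans E1)//.
have -> : 2 / eps * o / n%:R * S = (S / (n%:R * eps) + S / (n%:R * eps)) * o.
  by field; rewrite !gt_eqF.
apply: ler_wpM2r => //; apply: lerD; rewrite ler_pdivlMr ?mulr_gt0//.
  by rewrite mulrC -mulrA.
by rewrite mulrC -mulrA.
Qed.

(** The minimum of h' separates the two sums: the left one is at most tau (min h' + e), the right
    one at least tau min h' + tau e. *)
Lemma wsum_le (u v h h' : 'I_n.+1 -> R) tau e :
  (forall i, 0 <= u i) -> (forall i, 0 <= v i) ->
  \sum_i u i = tau -> \sum_i v i = tau -> (forall i j, h i <= h' j + e) ->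
  \sum_i u i * h i <= \sum_i v i * h' i + tau * e.
Proof.
move=> u0 v0 uE vE hh'.
case: (@Order.TotalTheory.arg_minP _ _ _ (ord0 : 'I_n.+1) predT h' isT) => j _ jmin.
apply: (@le_trans _ _ (tau * (h' j + e))).
  by rewrite -uE mulr_suml; apply: ler_sum => i _; rewrite ler_wpM2l.
rewrite mulrDr lerD2r -vE mulr_suml; apply: ler_sum => i _.
by rewrite ler_wpM2l// jmin.
Qed.

(** Doeblin minorisation: every normalised weight is at least c = eps / (n + 1). Both averages thus
    contain c times the plain sum, a part of mass eps where the same index is compared with itself
    at cost a; the remaining masses 1 - eps are compared at the worst cost e. *)
Lemma wavg_contract eps w w' h h' a e : 0 <= eps ->
  (forall i, 0 < w i) -> (forall i, 0 < w' i) ->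
  (forall i j, eps * w i <= w j) -> (forall i j, eps * w' i <= w' j) ->
  (forall i, `|h i - h' i| <= a) -> (forall i j, `|h i - h' j| <= e) ->
  `|wavg w h - wavg w' h'| <= eps * a + (1 - eps) * e.
Proof.
move=> e0; pose c : R := eps / n.+1%:R.
have N0 : 0 < n.+1%:R :> R by rewrite ltr0n.
have sumc : \sum_(i < n.+1) c = eps.
  by rewrite sumr_const card_ord -mulr_natr divfK ?gt_eqF.
have key (v : 'I_n.+1 -> R) : (forall i, 0 < v i) ->
    (forall i j, eps * v i <= v j) ->
    (forall i, 0 <= v i / (\sum_j v j) - c) /\
    \sum_i (v i / (\sum_j v j) - c) = 1 - eps.
  move=> v0 vv; have V0 := sum_gt0 v0; split.
    move=> i; rewrite subr_ge0 ler_pdivlMr// mulrC /c mulrA ler_pdivrMr//.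
    rewrite mulr_suml (@le_trans _ _ (\sum_(j < n.+1) v i))//.
      by apply: ler_sum => j _; rewrite mulrC.
    by rewrite sumr_const card_ord mulr_natr.
  by rewrite sumrB sumc -mulr_suml divff ?gt_eqF.
have oneside (v v' g g' : 'I_n.+1 -> R) : (forall i, 0 < v i) -> (forall i, 0 < v' i) ->
    (forall i j, eps * v i <= v j) -> (forall i j, eps * v' i <= v' j) ->
    (forall i, `|g i - g' i| <= a) -> (forall i j, `|g i - g' j| <= e) ->
    wavg v g - wavg v' g' <= eps * a + (1 - eps) * e.
  move=> v0 v'0 vv vv' ga ge; have [k1 k2] := key v v0 vv.
  have [k3 k4] := key v' v'0 vv'.
  have split_avg (z f : 'I_n.+1 -> R) : wavg z f =
      \sum_i c * f i + \sum_i (z i / (\sum_j z j) - c) * f i.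
    rewrite -big_split /wavg mulr_suml; apply: eq_bigr => i _ /=.
    by rewrite -mulrDl addrC subrK mulrAC.
  rewrite !split_avg.
  have c0 : 0 <= c by rewrite divr_ge0// ltW.
  have H1 : \sum_i c * g i <= \sum_i c * g' i + eps * a.
    rewrite -sumc mulr_suml -big_split; apply: ler_sum => i _ /=.
    rewrite -mulrDr ler_wpM2l//.
    by have := ga i; rewrite ler_distl => /andP[_]; rewrite addrC.
  have H2 := @wsum_le _ _ g g' (1 - eps) e k1 k3 k2 k4.
  have {}H2 := H2 (fun i j => proj2 (andP (etrans (esym (ler_distl _ _ _)) (ge i j)))).
  lra.
move=> w0 w'0 ww ww' ha he; rewrite ler_norml oneside// andbT lerNl opprB.
apply: oneside => // [i|i j]; rewrite distrC; [exact: ha|exact: he].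
Qed.

End weighted_average.

(** * Particle clouds and backward sampling *)

(** Equal nonempty tuples qualify, so that a bound c over such pairs also yields 0 <= c. *)
Definition differ_at_most1 (U : Type) (n : nat) (s s' : n.-tuple U) : Prop :=
  exists i0, forall i, i != i0 -> tnth s i = tnth s' i.

(** * Replacing i.i.d. particles one at a time *)

Section iid.
Context d (A : measurableType d) (R : realType).
Implicit Types m : giry A R.

Lemma measurable_cons2 n :
  measurable_fun [set: A * n.-tuple A] (fun z => cons_tuple z.1 z.2).
Proof. exact: measurable_cons. Qed.

Lemma measurable_ret_cons n (a : A) :
  measurable_fun [set: n.-tuple A] (fun s => @giry_ret _ _ R (cons_tuple a s)).
Proof.
by apply: (measurableT_comp measurable_giry_ret); exact: measurable_cons.
Qed.

Lemma integral_iidS n m (f : n.+1.-tuple A -> \bar R) :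
  measurable_fun [set: n.+1.-tuple A] f -> (forall s, 0 <= f s)%E ->
  (\int[iid n.+1 m]_s f s = \int[m]_a \int[iid n m]_s f (cons_tuple a s))%E.
Proof.
move=> mf f0 /=; rewrite integral_bind//; last first.
  apply: measurable_bind => //.
  by apply: (measurableT_comp measurable_giry_ret); exact: measurable_cons2.
apply: eq_integral => a _; rewrite integral_bind//; last exact: measurable_ret_cons.
by apply: eq_integral => s _; rewrite integral_ret.
Qed.

Lemma Ex_iidS n m (f : n.+1.-tuple A -> R) : test f ->
  Ex (iid n.+1 m) f = Ex m (fun a => Ex (iid n m) (fun s => f (cons_tuple a s))).
Proof.
move=> tf; rewrite Ex_bind//; last first.
  apply: measurable_bind => //.
  by apply: (measurableT_comp measurable_giry_ret); exact: measurable_cons2.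
apply: eq_Ex => a; rewrite Ex_bind//; last exact: measurable_ret_cons.
by apply: eq_Ex => s; rewrite Ex_ret.
Qed.

Lemma test_cons n (f : n.+1.-tuple A -> R) : test f ->
  test (fun z : A * n.-tuple A => f (cons_tuple z.1 z.2)).
Proof. by move=> tf; exact: (test_comp tf (@measurable_cons2 n)). Qed.

Lemma test_cons1 n (f : n.+1.-tuple A -> R) a : test f ->
  test (fun s : n.-tuple A => f (cons_tuple a s)).
Proof.
by move=> tf; apply: (test_comp tf); exact: measurable_cons.
Qed.

Lemma tnth_consS (U : Type) n (a : U) (s : n.-tuple U) (i : 'I_n) :
  tnth (cons_tuple a s) (lift ord0 i) = tnth s i.
Proof. by rewrite (tnth_nth a) lift0/= -tnth_nth. Qed.

Lemma differ_cons_head n (a b : A) (s : n.-tuple A) :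
  differ_at_most1 (cons_tuple a s) (cons_tuple b s).
Proof.
exists ord0 => i; case: (unliftP ord0 i) => [j ->|->]; last by rewrite eqxx.
by rewrite !tnth_consS.
Qed.

Lemma differ_cons_tail n (a : A) (s s' : n.-tuple A) :
  differ_at_most1 s s' -> differ_at_most1 (cons_tuple a s) (cons_tuple a s').
Proof.
move=> [i0 h]; exists (lift ord0 i0) => i.
case: (unliftP ord0 i) => [j ->|->] //; rewrite !tnth_consS => ji; apply: h.
by apply: contra ji => /eqP ->.
Qed.

(** Telescoping: the law of one coordinate is changed from m to m' at a time. As a function of that
    coordinate, the expectation over the others varies by at most c, so each exchange costs delta.
    In the application delta is of order c / n, and the n exchanges together cost O(c). *)
Lemma Ex_iid_dist n m m' (f : n.-tuple A -> R) c delta :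
  m [set: A] = 1%E -> m' [set: A] = 1%E -> test f -> 0 <= delta ->
  (forall s s', differ_at_most1 s s' -> `|f s - f s'| <= c) ->
  (forall phi, test phi -> (forall a b, `|phi a - phi b| <= c) ->
     `|Ex m phi - Ex m' phi| <= delta) ->
  `|Ex (iid n m) f - Ex (iid n m') f| <= n%:R * delta.
Proof.
move=> m1 m'1 + d0 + hd; elim: n f => [|n ih] f tf fc.
  by rewrite !Ex_ret// subrr normr0 mul0r.
rewrite !Ex_iidS//.
have tE (q : giry A R) : test (fun a => Ex (iid n q) (fun s => f (cons_tuple a s))).
  by apply: test_Ex; [exact: measurable_cst|exact: test_cons].
rewrite (le_trans (ler_distD
  (Ex m (fun a => Ex (iid n m') (fun s => f (cons_tuple a s)))) _ _))//.
rewrite -natr1 mulrDl mul1r lerD//.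
  apply: Ex_dist => //; first exact: sprobability_setT.
    move=> a; apply: ih; first exact: test_cons1.
    by move=> s s' ss'; apply: fc; exact: differ_cons_tail.
  by rewrite mulr_ge0.
apply: hd => // a b; apply: Ex_dist; [exact: sprobability_setT|exact: test_cons1..| |].
  by move=> s; apply: fc; exact: differ_cons_head.
apply: le_trans (fc (cons_tuple a point) (cons_tuple a point) _) => //.
by exists ord0.
Qed.

End iid.

(** * Backward sampling as an operator on functions *)

Section back.
Context d (X : measurableType d) (R : realType).
Variable mu : {sigma_finite_measure set X -> \bar R}.
Context T (m : model mu T.+1) (n : nat).
Local Notation cloud := (n.+1.-tuple (X * X)%type).

(** The backward kernel in dual form: a function of paths from time t becomes a function of paths
    from time t + 1. The path p enters the weights only through its first position. *)
Definition back k t (s : cloud) (g : k.+2.-tuple X -> R) (p : k.+1.-tuple X) : R :=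
  wavg (back_weight m t s (thead p)) (fun j => g (cons_tuple (tnth s j).2 p)).

(* The expectation of [g] under [run], when the backward path is replaced by a
   constant one [r] steps after time [t] (unless the horizon comes first). *)
Fixpoint lookahead r k t (s : cloud) (x : nat -> X) {struct k} :
    (k.+1.-tuple X -> R) -> R :=
  if k is k'.+1 then fun g =>
    if r is r'.+1 then
      Ex (step m t s (x t.+1)) (fun s' => lookahead r' t.+1 s' x (back t s g))
    else g (nseq_tuple k'.+2 point)
  else fun g =>
    wavg (fun i => potential m t (tnth s i)) (fun j => g [tuple (tnth s j).2]).

Hypothesis hm : strong_mixing m.

Lemma back_weight_gt0 t (s : cloud) y i : (1 <= t <= T)%N ->
  0 < back_weight m t s y i.
Proof.
move=> /andP[t1 tT]; have tT1 : (2 <= t.+1 <= T.+1)%N by rewrite !ltnS t1.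
have tT0 : (1 <= t <= T.+1)%N by rewrite t1 leqW.
rewrite /back_weight !mulr_gt0 ?(potential_gt0 hm) ?(M_gt0 hm)//.
have := @potential_gt0 _ _ _ _ _ _ hm t.+1 ((tnth s i).2, y).
by rewrite /potential eqSS gtn_eqF//; apply; case/andP: tT1.
Qed.

Lemma test_wavg d0 (E : measurableType d0) (w h : E -> 'I_n.+1 -> R) :
  (forall e i, 0 < w e i) ->
  (forall i, measurable_fun [set: E] (w ^~ i)) ->
  (forall i, test (h ^~ i)) -> test (fun e => wavg (w e) (h e)).
Proof.
move=> w0 mw th; split=> [|e].
  apply: measurable_funM.
    by apply: measurable_sum => i; apply: measurable_funM => //; case: (th i).
  by apply: (measurableT_comp (@measurable_inv R)); exact: measurable_sum.
by apply: wavg_itv => // i; have [_ h01] := th i; exact: h01.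
Qed.

Lemma measurable_back_weight d0 (E : measurableType d0) t (s : E -> cloud)
    (y : E -> X) i : (1 <= t <= T)%N -> measurable_fun [set: E] s ->
  measurable_fun [set: E] y ->
  measurable_fun [set: E] (fun e => back_weight m t (s e) (y e) i).
Proof.
move=> /andP[t1 tT] ms my.
have tT1 : (2 <= t.+1 <= T.+1)%N by rewrite !ltnS t1.
have mv := measurableT_comp (@measurable_val _ _ n i) ms.
apply: measurable_funM; last exact: (measurable_MG m tT1 mv my).2.
apply: measurable_funM; last exact: (measurable_MG m tT1 mv my).1.
have tT0 : (1 <= t <= T.+1)%N by rewrite t1 leqW.
exact: (measurableT_comp (measurable_weight m i tT0) ms).
Qed.

Lemma test_back k t d0 (E : measurableType d0) (s : E -> cloud)
    (g : E -> k.+2.-tuple X -> R) : (1 <= t <= T)%N ->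
  measurable_fun [set: E] s -> test (fun z : E * _ => g z.1 z.2) ->
  test (fun z : E * k.+1.-tuple X => back t (s z.1) (g z.1) z.2).
Proof.
move=> tT ms tg; apply: test_wavg => [e i|i|i].
- exact: back_weight_gt0.
- apply: measurable_back_weight => //; first exact: (measurableT_comp ms).
  exact: (measurableT_comp (measurable_tnth ord0)).
pose h (z : E * k.+1.-tuple X) := (z.1, cons_tuple (tnth (s z.1) i).2 z.2).
apply: (@test_comp _ _ _ _ _ _ h tg); apply: measurable_fun_pair => //.
apply: measurable_cons => //; apply: (measurableT_comp (@measurable_val _ _ n i)).
exact: (measurableT_comp ms).
Qed.

Lemma test_back1 k t (s : cloud) (g : k.+2.-tuple X -> R) : (1 <= t <= T)%N ->
  test g -> test (back t s g).
Proof.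
move=> tT tg.
have tg' : test (fun z : cloud * k.+2.-tuple X => g z.2) by exact: (test_comp tg).
have h := @test_back k t _ cloud id (fun=> g) tT (@measurable_id _ _ setT) tg'.
apply: (@test_comp _ _ _ _ _ _ (fun p : k.+1.-tuple X => (s, p)) h).
exact: measurable_fun_pair.
Qed.

Lemma time_lt k t : (1 <= t)%N -> (t + k.+1 <= T.+1)%N -> (1 <= t <= T)%N.
Proof. by lia. Qed.

(** The cloud, the reference and the function all depend on a parameter e because the induction step
    adds the next cloud to the parameter space, and [g] becomes [back t (s e) (g e)]. *)
Lemma test_lookahead r k t d0 (E : measurableType d0) (s : E -> cloud)
    (x : E -> nat -> X) (g : E -> k.+1.-tuple X -> R) :
  (1 <= t)%N -> (t + k <= T.+1)%N -> measurable_fun [set: E] s ->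
  (forall t, measurable_fun [set: E] (fun e => x e t)) ->
  test (fun z : E * _ => g z.1 z.2) ->
  test (fun e => lookahead r t (s e) (x e) (g e)).
Proof.
elim: k r t d0 E s x g => [|k ih] r t d0 E s x g t1 tk ms mx tg /=.
  apply: test_wavg => [e i|i|i].
  - by apply: potential_gt0 => //; rewrite t1 -(addn0 t).
  - have tT : (1 <= t <= T.+1)%N by rewrite t1 -(addn0 t).
    exact: (measurableT_comp (measurable_weight m i tT) ms).
  pose h (e : E) := (e, [tuple (tnth (s e) i).2]).
  apply: (@test_comp _ _ _ _ _ _ h tg); apply: measurable_fun_pair => //.
  apply: measurable_cons; last exact: measurable_cst.
  exact: (measurableT_comp (@measurable_val _ _ n i)).
have tT := time_lt t1 tk.
case: r => [|r].
  apply: (@test_comp _ _ _ _ _ _ (fun e : E => (e, nseq_tuple k.+2 point)) tg).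
  exact: measurable_fun_pair.
have mst := measurableT_comp (@measurable_step _ _ _ _ _ m n t tT) (measurable_fun_pair ms (mx t.+1)).
apply: test_Ex; first exact: mst.
apply: (ih r t.+1 _ _ snd (fun z => x z.1)
  (fun z : E * cloud => back t (s z.1) (g z.1))) => //.
- by rewrite addSnnS.
- by move=> t'; exact: (measurableT_comp (mx t')).
have := test_back tT ms tg => h.
pose u (z : (E * cloud) * k.+1.-tuple X) := (z.1.1, z.2).
apply: (@test_comp _ _ _ _ _ _ u h); apply: measurable_fun_pair => //.
exact: (measurableT_comp measurable_fst).
Qed.

Lemma test_lookahead1 r k t (x : nat -> X) (g : k.+1.-tuple X -> R) :
  (1 <= t)%N -> (t + k <= T.+1)%N -> test g ->
  test (fun s => lookahead r t s x g).
Proof.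
move=> t1 tk tg.
apply: (@test_lookahead r k t _ cloud id (fun=> x) (fun=> g)) => //.
exact: (test_comp tg).
Qed.

(** The draw of J_t, performed last by [run], is integrated out given the later path, which turns
    [g] into [back t s g]. With depth k the horizon is reached before any truncation. *)
Lemma Ex_run k t (s : cloud) (x : nat -> X) (g : k.+1.-tuple X -> R) :
  (1 <= t)%N -> (t + k <= T.+1)%N -> test g ->
  Ex (run m k t s x) g = lookahead k t s x g.
Proof.
elim: k t s g => [|k ih] t s g t1 tk tg.
  have w0 i : 0 < potential m t (tnth s i).
    by apply: potential_gt0 => //; rewrite t1 -(addn0 t).
  rewrite /= Ex_bind// -Ex_categ//.
    by apply: eq_Ex => j; rewrite Ex_ret.
  by move=> i; case: tg => _ /(_ [tuple (tnth s i).2])/andP[].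
have tT := time_lt t1 tk.
have tk' : (t.+1 + k <= T.+1)%N by rewrite addSnnS.
have mb (E := (cloud * k.+1.-tuple X)%type) : measurable_fun [set: E]
    (fun z => bind (categ (back_weight m t s (thead z.2)))
      (fun j => @giry_ret _ _ R (cons_tuple (tnth s j).2 z.2))).
  apply: measurable_bind.
    apply: measurable_categ => i; apply: measurable_back_weight => //.
    exact: (measurableT_comp (measurable_tnth ord0)).
  apply: measurable_ord_pair => i /=.
  apply: (measurableT_comp measurable_giry_ret).
  by apply: measurable_cons => //.
have mb1 : measurable_fun [set: k.+1.-tuple X]
    (fun p => bind (categ (back_weight m t s (thead p)))
      (fun j => @giry_ret _ _ R (cons_tuple (tnth s j).2 p))).
  exact: (measurable_fun_pair2 s mb).
rewrite /= Ex_bind//; last first.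
  by apply: measurable_bind => //; exact: measurable_run.
apply: eq_Ex => s'; rewrite Ex_bind// -ih//; last exact: test_back1.
apply: eq_Ex => p; rewrite Ex_bind// /back -Ex_categ.
- by apply: eq_Ex => j; rewrite Ex_ret.
- by move=> i; exact: back_weight_gt0.
- by move=> i; case: tg => _ /(_ (cons_tuple (tnth s i).2 p))/andP[].
Qed.

End back.

(** * Contraction *)

Section contraction.
Context d (X : measurableType d) (R : realType).
Variable mu : {sigma_finite_measure set X -> \bar R}.
Context T (m : model mu T.+1) (n : nat).
Local Notation cloud := (n.+1.-tuple (X * X)%type).
Hypothesis hm : strong_mixing m.
Variables eps alpha : R.
Hypothesis eps_gt0 : 0 < eps.
Hypothesis eps_le1 : eps <= 1.
Hypothesis alpha_gt1 : 1 < alpha.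
Hypothesis alpha_small : (1 - eps) * alpha < 1.
Hypothesis n_gt0 : (0 < n)%N.
Hypothesis potential_ratio : forall t z z', (1 <= t <= T.+1)%N ->
  eps * potential m t z <= potential m t z'.
Hypothesis back_weight_ratio : forall t (s s' : cloud) y y' i j, (1 <= t <= T)%N ->
  eps * back_weight m t s y i <= back_weight m t s' y' j.

Let alpha_gt0 : 0 < alpha. Proof. exact: lt_trans alpha_gt1. Qed.

(** The fixed point of K = eps + (1 - eps) alpha K, see [osc_constE]; it is what a backward step
    reproduces in [osc_le_back]. *)
Definition osc_const : R := eps / (1 - (1 - eps) * alpha).
Local Notation K := osc_const.

Lemma osc_constE : eps + (1 - eps) * alpha * K = K.
Proof. by rewrite /osc_const; field; move: alpha_small; lra. Qed.

Lemma osc_const_ge1 : 1 <= K.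
Proof.
rewrite /osc_const ler_pdivlMr; last by move: alpha_small; lra.
by move: eps_le1 alpha_gt1; nra.
Qed.

Let K_ge0 : 0 <= K. Proof. exact: le_trans osc_const_ge1. Qed.

Let trunc_ge0 k r L : 0 <= L -> 0 <= K * L * alpha ^+ k / alpha ^+ r.
Proof.
move=> L0; have a0 j : 0 <= alpha ^+ j by rewrite exprn_ge0// ltW.
by apply: divr_ge0 => //; apply: mulr_ge0 => //; exact: mulr_ge0.
Qed.

(** Lipschitz with constant L for paths with a common beginning, and only with constant K L for
    arbitrary pairs: two paths with different first positions give different backward weights, so
    the constant L itself would not survive [back]. *)
Definition osc_le k (g : k.-tuple X -> R) (L : R) : Prop :=
  (forall p q, `|g p - g q| <= K * L * alpha ^+ k) /\
  (forall j (p q : k.-tuple X), (1 <= j <= k)%N -> take j p = take j q ->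
     `|g p - g q| <= L * alpha ^+ (k - j)).

(** For arbitrary p and q, [wavg_contract] applies: on the mass eps the selected particle is the
    same, so the extended paths share one position and cost L alpha^(k+1); on the rest they cost K L
    alpha^(k+2). The sum is K L alpha^(k+1) by the equation for K. If p and q share j >= 1
    positions, the backward weights coincide and the extended paths share j + 1 positions out of one
    more. *)
Lemma osc_le_back k t (s : cloud) (g : k.+2.-tuple X -> R) L : (1 <= t <= T)%N ->
  osc_le g L -> osc_le (back m t s g) L.
Proof.
move=> tT [g0 g1]; split=> [p q|j p q /andP[j1 jk] pq].
  have -> : K * L * alpha ^+ k.+1 =
      eps * (L * alpha ^+ k.+1) + (1 - eps) * (K * L * alpha ^+ k.+2).
    by rewrite -{1}osc_constE [alpha ^+ k.+2]exprS; ring.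
  apply: wavg_contract; first exact: ltW.
  - by move=> i; exact: back_weight_gt0.
  - by move=> i; exact: back_weight_gt0.
  - by move=> i j; exact: back_weight_ratio.
  - by move=> i j; exact: back_weight_ratio.
  - move=> i; have := g1 1%N (cons_tuple (tnth s i).2 p) (cons_tuple (tnth s i).2 q).
    by rewrite subn1 /= !take0; exact.
  - by move=> i j; exact: g0.
have -> : back m t s g q =
    wavg (back_weight m t s (thead p)) (fun j => g (cons_tuple (tnth s j).2 q)).
  rewrite /back (_ : thead q = thead p)//.
  case/tupleP: p pq => a p; case/tupleP: q => b q; rewrite !theadE.
  by case: j j1 jk => // j _ _ /= [].
apply: wavg_dist => [i|i]; first exact: back_weight_gt0.
rewrite -(subSS j k.+1); apply: g1; first by lia.
by rewrite /= pq.
Qed.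

Lemma back_osc k t (s : cloud) (g : k.+2.-tuple X -> R) o : (1 <= t <= T)%N ->
  (forall p q, `|g p - g q| <= o) ->
  forall p q, `|back m t s g p - back m t s g q| <= o.
Proof.
move=> tT go p q; apply: wavg_dev => [i|i]; first exact: back_weight_gt0.
by rewrite distrC; apply: wavg_dev => [j|j]; [exact: back_weight_gt0|exact: go].
Qed.

Lemma back_change1 k t (s s' : cloud) (g : k.+2.-tuple X -> R) o : (1 <= t <= T)%N ->
  differ_at_most1 s s' -> (forall p q, `|g p - g q| <= o) ->
  forall p, `|back m t s g p - back m t s' g p| <= 2 / eps * o / n%:R.
Proof.
move=> tT [i0 ss'] go p; apply: (wavg_change1 (i0 := i0)) => //.
- by move=> i; exact: back_weight_gt0.
- by move=> i; exact: back_weight_gt0.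
- by move=> i j; exact: back_weight_ratio.
- by move=> i j; exact: back_weight_ratio.
- by move=> i ii0; rewrite /back_weight ss'.
Qed.

Lemma measurable_ret_pair (x : X) :
  measurable_fun [set: X] (fun y => @giry_ret _ _ R (x, y)).
Proof.
by apply: (measurableT_comp measurable_giry_ret); exact: measurable_fun_pair.
Qed.

Lemma propagate_setT t (s : cloud) : (1 <= t <= T)%N ->
  propagate m t s [set: X * X] = 1%E.
Proof.
move=> /andP[t1 tT]; have tT' : (2 <= t.+1 <= T.+1)%N by rewrite !ltnS t1.
apply: bind_setT => // [|a].
  by apply: categ_setT => i; apply: (potential_gt0 hm); rewrite t1 leqW.
apply: bind_setT; [exact: measurable_ret_pair| |by move=> y; exact: diracT].
exact: draw_setT (M_density _ tT' _).
Qed.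

Lemma Ex_propagate t (s : cloud) (f : X * X -> R) : (1 <= t <= T)%N -> test f ->
  Ex (propagate m t s) f = wavg (fun i => potential m t (tnth s i))
    (fun i => Ex (draw mu (M m t.+1 (tnth s i).2)) (fun y => f ((tnth s i).2, y))).
Proof.
move=> /andP[t1 tT] tf; rewrite Ex_bind// -Ex_categ.
- apply: eq_Ex => i; rewrite Ex_bind//; last exact: measurable_ret_pair.
  by apply: eq_Ex => y; rewrite Ex_ret.
- by move=> i; apply: (potential_gt0 hm); rewrite t1 leqW.
- move=> i.
  suff /andP[] : 0 <= Ex (draw mu (M m t.+1 (tnth s i).2))
      (fun y => f ((tnth s i).2, y)) <= 1 by [].
  apply: Ex_itv; first exact: sprobability_setT.
  by apply: (test_comp tf); exact: measurable_fun_pair.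
Qed.

Lemma propagate_change1 t (s s' : cloud) (f : X * X -> R) c : (1 <= t <= T)%N ->
  differ_at_most1 s s' -> test f -> (forall a b, `|f a - f b| <= c) ->
  `|Ex (propagate m t s) f - Ex (propagate m t s') f| <= 2 / eps * c / n%:R.
Proof.
move=> tT [i0 ss'] tf fc; rewrite !Ex_propagate//; case/andP: tT => t1 tT.
have tT' : (2 <= t.+1 <= T.+1)%N by rewrite !ltnS t1.
have tT0 : (1 <= t <= T.+1)%N by rewrite t1 leqW.
have tfx x : test (fun y => f (x, y)).
  by apply: (test_comp tf); exact: measurable_fun_pair.
have dM x : draw mu (M m t.+1 x) [set: X] = 1%E := draw_setT (M_density _ tT' _).
apply: (wavg_change1 (i0 := i0)) => //.
- by move=> i; exact: potential_gt0.
- by move=> i; exact: potential_gt0.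
- by move=> i j; exact: potential_ratio.
- by move=> i j; exact: potential_ratio.
- by move=> i ii0; rewrite ss'.
- by move=> i j; apply: Ex_dev2; [exact: dM|exact: dM|exact: tfx|exact: tfx|move=> a b; exact: fc].
- by move=> i j; apply: Ex_dev2; [exact: dM|exact: dM|exact: tfx|exact: tfx|move=> a b; exact: fc].
Qed.

Lemma Ex_step t (s : cloud) x (f : cloud -> R) : test f ->
  Ex (step m t s x) f =
  Ex (iid n (propagate m t s)) (fun s' => f (cons_tuple ((tnth s ord0).2, x) s')).
Proof.
move=> tf; rewrite Ex_bind//; last exact: measurable_ret_cons.
by apply: eq_Ex => s'; rewrite Ex_ret.
Qed.

(** The summand 1 pays for the reference, whose stored ancestor may be the changed particle. The n
    other particles are redrawn from a law perturbed by O(c / n) each, hence the summand 2 / eps. *)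
Lemma step_change1 t (s s' : cloud) x (f : cloud -> R) c : (1 <= t <= T)%N ->
  differ_at_most1 s s' -> test f ->
  (forall s1 s2, differ_at_most1 s1 s2 -> `|f s1 - f s2| <= c) ->
  `|Ex (step m t s x) f - Ex (step m t s' x) f| <= (1 + 2 / eps) * c.
Proof.
move=> tT ss' tf fc; rewrite !Ex_step//.
have c0 : 0 <= c.
  by apply: le_trans (fc s s _) => //; exists ord0.
set x0 := (_, x); set x0' := (_, x).
rewrite (le_trans (ler_distD
  (Ex (iid n (propagate m t s)) (fun s1 => f (cons_tuple x0' s1))) _ _))//.
rewrite mulrDl mul1r lerD//.
  apply: Ex_dist => //; [exact: sprobability_setT|exact: test_cons1..|].
  by move=> s1; apply: fc; exact: differ_cons_head.
have -> : 2 / eps * c = n%:R * (2 / eps * c / n%:R).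
  by rewrite [RHS]mulrC divfK// pnatr_eq0 -lt0n.
apply: (@Ex_iid_dist _ _ _ n _ _ _ c); rewrite ?propagate_setT//.
- exact: test_cons1.
- by rewrite !mulr_ge0// invr_ge0 ltW.
- by move=> s1 s2 s12; apply: fc; exact: differ_cons_tail.
- by move=> f' tf' f'c; exact: propagate_change1.
Qed.

Lemma step_change_ref t (s : cloud) x x' (f : cloud -> R) c : test f -> 0 <= c ->
  (forall s1 s2, differ_at_most1 s1 s2 -> `|f s1 - f s2| <= c) ->
  `|Ex (step m t s x) f - Ex (step m t s x') f| <= c.
Proof.
move=> tf c0 fc; rewrite !Ex_step//.
apply: Ex_dist => //; [exact: sprobability_setT|exact: test_cons1..|].
by move=> s1; apply: fc; exact: differ_cons_head.
Qed.

(** Cost, in units of o / n, of changing one particle: 2 / eps for its role in the current selection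
    of a backward index (or in the final draw at the horizon), and [1 + 2 / eps] times the cost at
    the next time for its effect on the next cloud. It depends neither on n nor on the horizon. *)
Fixpoint lip_const r : R :=
  if r is r'.+1 then 2 / eps + (1 + 2 / eps) * lip_const r' else 2 / eps.

(** Each of the r reference positions ahead is one changed particle, charged with the [lip_const] of
    the depth that then remains. *)
Fixpoint ref_const r : R :=
  if r is r'.+1 then ref_const r' + lip_const r' else 0.

Let eps2_ge0 : 0 <= 2 / eps. Proof. by rewrite divr_ge0// ltW. Qed.

Lemma lip_const_ge r : 2 / eps <= lip_const r.
Proof.
elim: r => //= r ih; rewrite lerDl mulr_ge0//; first by rewrite addr_ge0.
exact: le_trans ih.
Qed.

Lemma ref_const_ge0 r : 0 <= ref_const r.
Proof.
by elim: r => //= r ih; rewrite addr_ge0// (le_trans _ (lip_const_ge r)).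
Qed.

Lemma lookahead_dist r k t (s : cloud) x (g g' : k.+1.-tuple X -> R) c :
  (1 <= t)%N -> (t + k <= T.+1)%N -> test g -> test g' ->
  (forall p, `|g p - g' p| <= c) ->
  `|lookahead m r t s x g - lookahead m r t s x g'| <= c.
Proof.
elim: k r t s g g' => [|k ih] r t s g g' t1 tk tg tg' gg' /=.
  apply: wavg_dist => // i; apply: potential_gt0 => //.
  by rewrite t1 -(addn0 t).
case: r => [|r] //; have tT := time_lt t1 tk.
have tk' : (t.+1 + k <= T.+1)%N by rewrite addSnnS.
apply: Ex_dist; first exact: sprobability_setT.
- by apply: test_lookahead1 => //; exact: test_back1.
- by apply: test_lookahead1 => //; exact: test_back1.
- move=> s'; apply: ih => //; [exact: test_back1..|].
  by move=> p; apply: wavg_dist => // i; exact: back_weight_gt0.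
- exact: le_trans (gg' (nseq_tuple k.+2 point)).
Qed.

(** The cloud acts twice, through the function [back t s g] and through the law of the next cloud;
    the two effects give the two terms of [lip_const]. *)
Lemma lookahead_change1 r k t (s s' : cloud) x (g : k.+1.-tuple X -> R) o :
  (1 <= t)%N -> (t + k <= T.+1)%N -> test g -> differ_at_most1 s s' ->
  (forall p q, `|g p - g q| <= o) ->
  `|lookahead m r t s x g - lookahead m r t s' x g| <= o / n%:R * lip_const r.
Proof.
elim: k r t s s' g => [|k ih] r t s s' g t1 tk tg ss' go /=.
  have tT : (1 <= t <= T.+1)%N by rewrite t1 -(addn0 t).
  have o0 : 0 <= o by apply: le_trans (go [tuple point] [tuple point]).
  apply: (@le_trans _ _ (2 / eps * o / n%:R)); last first.
    by rewrite -mulrA [leLHS]mulrC ler_wpM2l ?divr_ge0// lip_const_ge.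
  have [i0 h] := ss'; apply: (wavg_change1 (i0 := i0)) => //.
  - by move=> i; exact: potential_gt0.
  - by move=> i; exact: potential_gt0.
  - by move=> i j; exact: potential_ratio.
  - by move=> i j; exact: potential_ratio.
  - by move=> i ii0; rewrite h.
have o0 : 0 <= o.
  by apply: le_trans (go (nseq_tuple k.+2 point) (nseq_tuple k.+2 point)).
case: r => [|r].
  by rewrite subrr normr0 mulr_ge0 ?divr_ge0//= ltW.
have tT := time_lt t1 tk.
have tk' : (t.+1 + k <= T.+1)%N by rewrite addSnnS.
have tL s1 : test (fun s2 => lookahead m r t.+1 s2 x (back m t s1 g)).
  by apply: test_lookahead1 => //; exact: test_back1.
rewrite (le_trans (ler_distD (Ex (step m t s (x t.+1))
  (fun s2 => lookahead m r t.+1 s2 x (back m t s' g))) _ _))//=.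
rewrite mulrDr lerD//.
  apply: Ex_dist; [exact: sprobability_setT|exact: tL..| |].
    move=> s1; apply: lookahead_dist => //; [exact: test_back1..|].
    move=> p; rewrite (le_trans (back_change1 tT ss' go p))//.
    by rewrite -[leLHS]mulrA [leLHS]mulrC.
  by rewrite mulr_ge0// divr_ge0.
rewrite mulrCA; apply: step_change1 => // s1 s2 s12.
by apply: ih => //; [exact: test_back1|exact: back_osc].
Qed.

Lemma lookahead_change_ref r k t (s : cloud) x x' (g : k.+1.-tuple X -> R) o :
  (1 <= t)%N -> (t + k <= T.+1)%N -> test g ->
  (forall p q, `|g p - g q| <= o) ->
  `|lookahead m r t s x g - lookahead m r t s x' g| <= o / n%:R * ref_const r.
Proof.
elim: k r t s g => [|k ih] r t s g t1 tk tg go /=.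
  have o0 : 0 <= o by apply: le_trans (go [tuple point] [tuple point]).
  by rewrite subrr normr0 mulr_ge0 ?divr_ge0// ref_const_ge0.
have o0 : 0 <= o.
  by apply: le_trans (go (nseq_tuple k.+2 point) (nseq_tuple k.+2 point)).
case: r => [|r].
  by rewrite subrr normr0 mulr_ge0 ?divr_ge0.
have tT := time_lt t1 tk.
have tk' : (t.+1 + k <= T.+1)%N by rewrite addSnnS.
have tB := test_back1 hm s tT tg.
have tL y : test (fun s2 => lookahead m r t.+1 s2 y (back m t s g)).
  exact: test_lookahead1.
have bo := back_osc s tT go.
rewrite (le_trans (ler_distD (Ex (step m t s (x t.+1))
  (fun s2 => lookahead m r t.+1 s2 x' (back m t s g))) _ _))//=.
rewrite mulrDr lerD//.
  apply: Ex_dist; [exact: sprobability_setT|exact: tL..| |].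
    by move=> s1; exact: ih.
  by rewrite mulr_ge0 ?divr_ge0// ref_const_ge0.
apply: step_change_ref => //.
  by rewrite mulr_ge0 ?divr_ge0//; exact: le_trans (lip_const_ge r).
by move=> s1 s2 s12; exact: lookahead_change1.
Qed.

(** After r backward steps the function still satisfies [osc_le] with the same L, but on paths
    shorter by r. Replacing its argument by a constant path then costs at most its total
    oscillation, K L alpha^(k+1-r). *)
Lemma lookahead_trunc r k t (s : cloud) x (g : k.+1.-tuple X -> R) L :
  0 <= L -> (1 <= t)%N -> (t + k <= T.+1)%N -> test g -> osc_le g L ->
  `|lookahead m k t s x g - lookahead m r t s x g| <=
    K * L * alpha ^+ k.+1 / alpha ^+ r.
Proof.
move=> L0; elim: k r t s g => [|k ih] r t s g t1 tk tg gL.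
  by rewrite subrr normr0 trunc_ge0.
case: r => [|r].
  rewrite expr0 divr1 -[lookahead m k.+1 _ _ _ _](Ex_run hm)//.
  apply: Ex_dev => //; first exact: run_setT.
    by move=> p; exact: gL.1.
  by case: tg => _; exact.
have tT := time_lt t1 tk.
have tk' : (t.+1 + k <= T.+1)%N by rewrite addSnnS.
have tB := test_back1 hm s tT tg.
apply: Ex_dist; [exact: sprobability_setT|exact: test_lookahead1..| |].
  move=> s1; rewrite (le_trans (ih r _ _ _ _ tk' tB (osc_le_back s tT gL)))//.
  suff -> : K * L * alpha ^+ k.+2 / alpha ^+ r.+1 = K * L * alpha ^+ k.+1 / alpha ^+ r.
    by [].
  rewrite [alpha ^+ k.+2]exprS [alpha ^+ r.+1]exprS [K * L * _]mulrCA.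
  by rewrite -mulf_div divff ?gt_eqF// mul1r.
exact: trunc_ge0.
Qed.

(** The sum of the four errors in [lookahead_contract]: two truncations, one changed particle, and
    the changed references, the last two with o = K L alpha^(k+1). *)
Definition rate r : R :=
  K * (2 / alpha ^+ r + (lip_const r + ref_const r) / n%:R).

Lemma lookahead_contract r k t (s s' : cloud) x x' (g : k.+1.-tuple X -> R) L :
  0 <= L -> (1 <= t)%N -> (t + k <= T.+1)%N -> test g -> osc_le g L ->
  differ_at_most1 s s' ->
  `|lookahead m k t s x g - lookahead m k t s' x' g| <= rate r * L * alpha ^+ k.+1.
Proof.
move=> L0 t1 tk tg gL ss'.
have h1 := lookahead_trunc r s x L0 t1 tk tg gL.
have h2 := lookahead_change1 r x t1 tk tg ss' gL.1.
have h3 := lookahead_change_ref r s' x x' t1 tk tg gL.1.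
have := lookahead_trunc r s' x' L0 t1 tk tg gL; rewrite distrC => h4.
rewrite (le_trans (ler_distD (lookahead m r t s x g) _ _))//.
rewrite (le_trans (lerD h1 (ler_distD (lookahead m r t s' x g) _ _)))//.
rewrite (le_trans (lerD (lexx _) (lerD h2 (ler_distD (lookahead m r t s' x' g) _ _))))//.
rewrite (le_trans (lerD (lexx _) (lerD (lexx _) (lerD h3 h4))))//.
by rewrite le_eqVlt /rate; apply/orP; left; apply/eqP; ring.
Qed.

(** While the references agree, the next clouds have the same law, so the difference passes inside
    the expectation at no cost. Each such step pulls [g] back to paths shorter by one, which gains a
    factor alpha. *)
Lemma lookahead_common r i k t (s : cloud) x x' (g : k.+1.-tuple X -> R) L :
  0 <= L -> (1 <= t)%N -> (t + k <= T.+1)%N -> test g -> osc_le g L ->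
  (i <= k)%N -> (forall u, (t < u <= t + i)%N -> x u = x' u) ->
  `|lookahead m k t s x g - lookahead m k t s x' g| <=
    rate r * L * alpha ^+ (k.+1 - i).
Proof.
move=> L0; elim: i k t s g => [|i ih] k t s g t1 tk tg gL ik xx'.
  by rewrite subn0; apply: lookahead_contract => //; exists ord0.
case: k g tk tg gL ik => // k g tk tg gL ik.
have tT := time_lt t1 tk.
have tk' : (t.+1 + k <= T.+1)%N by rewrite addSnnS.
have tB := test_back1 hm s tT tg.
rewrite subSS /= xx'; last by lia.
apply: Ex_dist; [exact: sprobability_setT|exact: test_lookahead1..| |].
  move=> s1; apply: ih => //; first exact: osc_le_back.
  by move=> u tu; apply: xx'; lia.
(* The cloud here is arbitrary: only the non-negativity of the bound is extracted. *)
have := ih k t.+1 s (back m t s g) isT tk' tB (osc_le_back s tT gL) ik.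
move=> h; apply: le_trans (h _) => //.
by move=> u tu; apply: xx'; lia.
Qed.

Lemma measurable_init_draw :
  measurable_fun [set: X] (fun y => @giry_ret _ (X * X)%type R (y, y)).
Proof.
by apply: (measurableT_comp measurable_giry_ret); exact: measurable_fun_pair.
Qed.

Lemma Ex_init x (f : cloud -> R) : test f ->
  Ex (init m n x) f =
  Ex (iid n (bind (draw mu (M1 m)) (fun y => giry_ret (y, y))))
    (fun s => f (cons_tuple (x, x) s)).
Proof.
move=> tf; rewrite Ex_bind//; last exact: measurable_ret_cons.
by apply: eq_Ex => s'; rewrite Ex_ret.
Qed.

Lemma Ex_cbpf x (f : T.+1.-tuple X -> R) : test f ->
  Ex (cbpf m n x) f =
  Ex (init m n (Defs.coord x 1%N)) (fun s => lookahead m T 1%N s (Defs.coord x) f).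
Proof.
move=> tf; rewrite Ex_bind//; last first.
  by apply: measurable_run => // t; exact: measurable_cst.
by apply: eq_Ex => s; rewrite (Ex_run hm).
Qed.

(** Unlike in [osc_le], the case j = 0 carries the constant L too: this class is used between
    iterations of the sampler, where no K may accumulate. It implies [osc_le] because K >= 1. *)
Definition path_osc_le (f : T.+1.-tuple X -> R) (L : R) : Prop :=
  forall j (x y : T.+1.-tuple X), (j <= T.+1)%N -> take j x = take j y ->
    `|f x - f y| <= L * alpha ^+ (T.+1 - j).

(** The first common position of the references is used to identify the initial clouds, so
    [lookahead_common] sees only j out of j + 1 common positions; this is the extra factor alpha.
    With no common position the initial clouds differ in the reference particle only. *)
Lemma cbpf_contract r (f : T.+1.-tuple X -> R) L : 0 <= L -> test f ->
  path_osc_le f L -> path_osc_le (fun x => Ex (cbpf m n x) f) (rate r * alpha * L).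
Proof.
move=> L0 tf fL.
have gL : osc_le f L.
  split=> [p q|j p q /andP[j1 jT]]; last exact: fL.
  have := fL 0%N p q; rewrite !take0 subn0 => /(_ isT erefl) /le_trans; apply.
  by rewrite ler_wpM2r ?exprn_ge0 ?ler_peMl ?osc_const_ge1// ltW.
have rate0 : 0 <= rate r.
  apply: mulr_ge0 => //; apply: addr_ge0; apply: divr_ge0 => //.
    by rewrite exprn_ge0// ltW.
  by rewrite addr_ge0 ?ref_const_ge0//; exact: le_trans (lip_const_ge r).
have tl y : test (fun s : cloud => lookahead m T 1%N s y f) by exact: test_lookahead1.
move=> j x y jT xy; rewrite !Ex_cbpf// !Ex_init//.
case: j jT xy => [_ _|j jT xy].
  rewrite subn0; apply: (@le_trans _ _ (rate r * L * alpha ^+ T.+1)); last first.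
    rewrite ler_wpM2r ?exprn_ge0 ?(ltW alpha_gt0)// -mulrA ler_wpM2l//.
    by rewrite ler_peMl// ltW.
  apply: Ex_dist; [exact: sprobability_setT| | | |].
  - exact: (test_cons1 _ (tl _)).
  - exact: (test_cons1 _ (tl _)).
  - by move=> s; apply: lookahead_contract => //; exact: differ_cons_head.
  - by apply: mulr_ge0; [exact: mulr_ge0|rewrite exprn_ge0// ltW].
have cxy u : (1 <= u <= j.+1)%N -> Defs.coord x u = Defs.coord y u.
  case: u => // u /andP[_ uj]; rewrite /Defs.coord/=.
  by rewrite -(nth_take _ (uj : (u < j.+1)%N)) xy nth_take.
have -> : rate r * alpha * L * alpha ^+ (T.+1 - j.+1) =
    rate r * L * alpha ^+ (T.+1 - j).
  by rewrite subSS subSn// exprS; ring.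
rewrite (cxy 1%N)//.
apply: Ex_dist; [exact: sprobability_setT| | | |].
- exact: (test_cons1 _ (tl _)).
- exact: (test_cons1 _ (tl _)).
- move=> s; apply: lookahead_common => //.
  by move=> u uj; apply: cxy; lia.
- by apply: mulr_ge0; [exact: mulr_ge0|rewrite exprn_ge0// ltW].
Qed.

End contraction.

(** * Invariance of the target *)

Section exchangeability.
Context d (A : measurableType d) (R : realType).
Implicit Types q : giry A R.
Local Open Scope ereal_scope.

Lemma measurable_integral_sfinite d1 d2 (E : measurableType d1) (B : measurableType d2)
    (nu : {sigma_finite_measure set B -> \bar R}) (f : E -> B -> \bar R) :
  measurable_fun [set: E * B] (fun z => f z.1 z.2) -> (forall e b, 0 <= f e b) ->
  measurable_fun [set: E] (fun e => \int[nu]_b f e b).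
Proof.
move=> mf f0; apply: (@measurable_fun_fubini_tonelli_F _ _ _ _ _ nu _ mf).
by move=> z; exact: f0.
Qed.

Lemma integral_swap q (f : A -> A -> \bar R) :
  measurable_fun [set: A * A] (fun z => f z.1 z.2) -> (forall a b, 0 <= f a b) ->
  \int[q]_a \int[q]_b f a b = \int[q]_b \int[q]_a f a b.
Proof.
move=> mf f0.
exact: (@fubini_tonelli _ _ _ _ _ q q (fun z => f z.1 z.2) mf (fun=> f0 _ _)).
Qed.

(** Meant for the laws of a new particle given two clouds that are permutations of each other, which
    are known to agree through their integrals. *)
Lemma integral_iid_ext n q q' (f : n.-tuple A -> \bar R) :
  (forall h : A -> \bar R, measurable_fun [set: A] h -> (forall a, 0 <= h a) ->
    \int[q]_a h a = \int[q']_a h a) ->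
  measurable_fun [set: n.-tuple A] f -> (forall s, 0 <= f s) ->
  \int[iid n q]_s f s = \int[iid n q']_s f s.
Proof.
move=> qq'; elim: n f => [|n ih] f mf f0 //; rewrite !integral_iidS//.
have mfc a : measurable_fun [set: n.-tuple A] (fun s => f (cons_tuple a s)).
  by apply: (measurableT_comp mf); exact: measurable_cons.
rewrite qq'.
- by apply: eq_integral => a _; exact: ih.
- apply: (@measurable_integral _ _ _ _ _ (fun=> iid n q) (fun a s => f (cons_tuple a s))) => //.
  exact: (measurableT_comp mf (@measurable_cons2 _ A n)).
- by move=> a; exact: integral_ge0.
Qed.

Definition symmetric_in_tuple n (phi : A -> n.-tuple A -> \bar R) : Prop :=
  forall a (s s' : n.-tuple A), perm_eq s s' -> phi a s = phi a s'.

(** With the first coordinate a fixed, the induction hypothesis moves index i to the head b of the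
    remaining tuple. By symmetry a and b may be swapped inside the tuple, and Tonelli swaps their
    integrations. *)
Lemma iid_exchange n q (phi : A -> n.+1.-tuple A -> \bar R) i :
  measurable_fun [set: A * n.+1.-tuple A] (fun z => phi z.1 z.2) ->
  (forall a s, 0 <= phi a s) -> symmetric_in_tuple phi ->
  \int[iid n.+1 q]_s phi (tnth s i) s = \int[iid n.+1 q]_s phi (thead s) s.
Proof.
elim: n phi i => [|n ih] phi i mphi phi0 sphi; first by rewrite (ord1 i).
case: (unliftP ord0 i) => [j ->|->] //.
have mtn k : measurable_fun setT (fun s : n.+2.-tuple A => phi (tnth s k) s).
  have mpr : measurable_fun setT (fun s : n.+2.-tuple A => (tnth s k, s)).
    by apply: measurable_fun_pair => //; exact: measurable_tnth.
  exact: (measurableT_comp mphi mpr).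
rewrite integral_iidS//.
pose phia a b (s : n.+1.-tuple A) := phi b (cons_tuple a s).
transitivity (\int[q]_a \int[iid n.+1 q]_s phia a (tnth s j) s).
  by apply: eq_integral => a _; apply: eq_integral => s _; rewrite tnth_consS.
have mcc : measurable_fun [set: (A * A) * n.+1.-tuple A]
    (fun z => phi z.1.2 (cons_tuple z.1.1 z.2)).
  have mpr : measurable_fun [set: (A * A) * n.+1.-tuple A]
      (fun z => (z.1.2, cons_tuple z.1.1 z.2)).
    apply: measurable_fun_pair; first exact: (measurableT_comp measurable_snd).
    by apply: measurable_cons => //; exact: (measurableT_comp measurable_fst).
  exact: (measurableT_comp mphi mpr).
transitivity (\int[q]_a \int[iid n.+1 q]_s phia a (thead s) s).
  apply: eq_integral => a _; apply: ih => //.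
    have mpr : measurable_fun [set: A * n.+1.-tuple A] (fun z => ((a, z.1), z.2)).
      by apply: measurable_fun_pair => //; exact: measurable_fun_pair.
    exact: (measurableT_comp mcc mpr).
    by move=> b s; exact: phi0.
  by move=> b s s' ss'; apply: sphi; rewrite /= perm_cons.
pose f a b := \int[iid n q]_s phi b (cons_tuple b (cons_tuple a s)).
have mf3 : measurable_fun [set: (A * A) * n.-tuple A]
    (fun z => phi z.1.2 (cons_tuple z.1.2 (cons_tuple z.1.1 z.2))).
  have mpr : measurable_fun [set: (A * A) * n.-tuple A]
      (fun z => (z.1.2, cons_tuple z.1.2 (cons_tuple z.1.1 z.2))).
    have m2 : measurable_fun [set: (A * A) * n.-tuple A] (fun z => z.1.2).
      exact: (measurableT_comp measurable_snd).
    apply: measurable_fun_pair => //; apply: measurable_cons => //.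
    by apply: measurable_cons => //; exact: (measurableT_comp measurable_fst).
  exact: (measurableT_comp mphi mpr).
have mf : measurable_fun [set: A * A] (fun z => f z.1 z.2).
  exact: (@measurable_integral _ _ _ _ _ (fun=> iid n q)
    (fun z s => phi z.2 (cons_tuple z.2 (cons_tuple z.1 s)))).
have f0 a b : 0 <= f a b by exact: integral_ge0.
transitivity (\int[q]_a \int[q]_b f a b).
  apply: eq_integral => a _.
  have mpa : measurable_fun setT (fun s : n.+1.-tuple A => phia a (thead s) s).
    have mpr : measurable_fun setT (fun s : n.+1.-tuple A => ((a, thead s), s)).
      apply: measurable_fun_pair => //; apply: measurable_fun_pair => //.
      exact: measurable_tnth.
    exact: (measurableT_comp mcc mpr).
  rewrite integral_iidS//; last by move=> s; exact: phi0.
  apply: eq_integral => b _; apply: eq_integral => s _.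
  rewrite /phia theadE; apply: sphi.
  by rewrite /= -[a :: b :: s]/([:: a] ++ [:: b] ++ s) perm_catCA.
rewrite (integral_swap q mf f0).
rewrite integral_iidS//; last exact: (mtn ord0).
apply: eq_integral => b _; rewrite integral_iidS//.
have mcb : measurable_fun [set: n.+1.-tuple A]
    (fun s => (b, cons_tuple b s)).
  by apply: measurable_fun_pair => //; exact: measurable_cons.
exact: (measurableT_comp mphi mcb).
Qed.

(** By [iid_exchange], each side times n + 1 is the integral of the sum over all particles. An
    identity for a distinguished particle thus follows from a pointwise identity of sums. *)
Lemma iid_exchange_eq n q (phi psi : A -> n.+1.-tuple A -> \bar R) :
  measurable_fun [set: A * n.+1.-tuple A] (fun z => phi z.1 z.2) ->
  measurable_fun [set: A * n.+1.-tuple A] (fun z => psi z.1 z.2) ->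
  (forall a s, 0 <= phi a s) -> (forall a s, 0 <= psi a s) ->
  symmetric_in_tuple phi -> symmetric_in_tuple psi ->
  (forall s, \sum_(i < n.+1) phi (tnth s i) s = \sum_(i < n.+1) psi (tnth s i) s) ->
  \int[iid n.+1 q]_s phi (thead s) s = \int[iid n.+1 q]_s psi (thead s) s.
Proof.
move=> mphi mpsi phi0 psi0 sphi spsi E.
have key (f : A -> n.+1.-tuple A -> \bar R) :
    measurable_fun [set: A * n.+1.-tuple A] (fun z => f z.1 z.2) ->
    (forall a s, 0 <= f a s) -> symmetric_in_tuple f ->
    \int[iid n.+1 q]_s (\sum_(i < n.+1) f (tnth s i) s) =
    n.+1%:R%:E * \int[iid n.+1 q]_s f (thead s) s.
  move=> mf f0 sf; rewrite ge0_integral_sum//.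
    under eq_bigr do rewrite iid_exchange//.
    by rewrite sumr_const card_ord mule_natl.
  move=> i; have mpr : measurable_fun setT (fun s : n.+1.-tuple A => (tnth s i, s)).
    by apply: measurable_fun_pair => //; exact: measurable_tnth.
  exact: (measurableT_comp mf mpr).
have := key _ mphi phi0 sphi; under eq_integral do rewrite E.
rewrite key// => H.
have N0 : 0 < n.+1%:R%:E :> \bar R by rewrite lte_fin ltr0n.
by apply/eqP; rewrite eq_le; apply/andP; split; rewrite -(lee_pmul2l _ N0)// H.
Qed.

Lemma integral_iid_thead n q (h : A -> \bar R) : q [set: A] = 1 ->
  measurable_fun [set: A] h -> (forall a, 0 <= h a) ->
  \int[iid n.+1 q]_s h (thead s) = \int[q]_a h a.
Proof.
move=> q1 mh h0; rewrite integral_iidS//; last first.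
  exact: (measurableT_comp mh (measurable_tnth ord0)).
apply: eq_integral => a _; under eq_integral do rewrite theadE.
rewrite integral_cst// [X in _ * X](_ : _ = 1) ?mule1//.
exact: iid_setT.
Qed.

Lemma sum_tnth_perm (V : nmodType) n (f : A -> V) (s s' : n.-tuple A) :
  perm_eq s s' -> (\sum_(i < n) f (tnth s i) = \sum_(i < n) f (tnth s' i))%R.
Proof. by move=> ss'; rewrite -!(big_tuple _ _ _ xpredT f); exact: perm_big. Qed.

End exchangeability.

Section tuple_measure.
Context d (X : measurableType d) (R : realType).
Variable mu : {sigma_finite_measure set X -> \bar R}.
Local Open Scope ereal_scope.

Lemma integral_tuple_measureS k (f : k.+1.-tuple X -> \bar R) :
  measurable_fun [set: k.+1.-tuple X] f -> (forall p, 0 <= f p) ->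
  \int[tuple_measure mu k.+1]_p f p =
  \int[mu]_x \int[tuple_measure mu k]_p f (cons_tuple x p).
Proof.
move=> mf f0.
have mc := @measurable_cons2 _ X k.
rewrite (eq_measure_integral
  (pushforward (mu \x tuple_measure mu k) (fun z => cons_tuple z.1 z.2)))//.
rewrite ge0_integral_pushforward// fubini_tonelli1//.
  exact: (measurableT_comp mf mc).
by move=> z; exact: f0.
Qed.

Lemma integral_tuple_measure0 (f : 0.-tuple X -> \bar R) :
  \int[tuple_measure mu 0]_p f p = f [tuple].
Proof.
have -> : f = cst (f [tuple]) by apply/funext => p; rewrite tuple0.
by rewrite integral_cst// [X in _ * X](_ : _ = 1) ?mule1//; exact: diracT.
Qed.

End tuple_measure.

(** * Invariance for a run started at time t *)

Section invariance.
Context d (X : measurableType d) (R : realType).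
Variable mu : {sigma_finite_measure set X -> \bar R}.
Context T (m : model mu T.+1) (n : nat).
Local Notation cloud := (n.+1.-tuple (X * X)%type).
Hypothesis hm : strong_mixing m.
Local Open Scope ereal_scope.

(* The weight of the path [p] started at time [t.+1], given the position [y] at
   time [t]. *)
Fixpoint path_density t (y : X) (p : seq X) : R :=
  if p is x :: p' then
    (M m t.+1 y x * G m t.+1 y x * path_density t.+1 x p')%R
  else 1%R.

(* The reference used from time [t] on, when [p] lists its positions from time
   [t.+1] on. *)
Definition ref_from k t (p : k.-tuple X) (u : nat) : X := Defs.coord p (u - t).

Lemma MG_ge0 t y x : (1 <= t <= T)%N -> (0 <= M m t.+1 y x * G m t.+1 y x)%R.
Proof.
move=> /andP[t1 tT]; have tT1 : (2 <= t.+1 <= T.+1)%N by rewrite !ltnS t1.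
by rewrite mulr_ge0 ?G_ge0// ltW// (M_gt0 hm).
Qed.

Lemma measurable_MG_mul t d0 (E : measurableType d0) (y x : E -> X) :
  (1 <= t <= T)%N -> measurable_fun [set: E] y -> measurable_fun [set: E] x ->
  measurable_fun [set: E] (fun e => M m t.+1 (y e) (x e) * G m t.+1 (y e) (x e))%R.
Proof.
move=> /andP[t1 tT] my mx; have tT1 : (2 <= t.+1 <= T.+1)%N by rewrite !ltnS t1.
by have [h1 h2] := measurable_MG m tT1 my mx; exact: measurable_funM.
Qed.

Lemma path_density_ge0 k t y (p : k.-tuple X) : (1 <= t)%N -> (t + k <= T.+1)%N ->
  (0 <= path_density t y p)%R.
Proof.
elim: k t y p => [|k ih] t y p t1 tk; first by rewrite tuple0.
have tT := time_lt t1 tk.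
case/tupleP: p => x p /=; rewrite mulr_ge0 ?MG_ge0//.
by apply: ih; rewrite // addSnnS.
Qed.

Lemma measurable_path_density k t d0 (E : measurableType d0) (y : E -> X)
    (p : E -> k.-tuple X) : (1 <= t)%N -> (t + k <= T.+1)%N ->
  measurable_fun [set: E] y -> measurable_fun [set: E] p ->
  measurable_fun [set: E] (fun e => path_density t (y e) (p e)).
Proof.
elim: k t y p => [|k ih] t y p t1 tk my mp.
  rewrite (_ : (fun _ => _) = cst 1%R); first exact: measurable_cst.
  by apply/funext => e; rewrite tuple0.
have tT := time_lt t1 tk.
have tk' : (t.+1 + k <= T.+1)%N by rewrite addSnnS.
have mh : measurable_fun [set: E] (fun e => thead (p e)).
  exact: (measurableT_comp (measurable_tnth ord0) mp).
have mt : measurable_fun [set: E] (fun e => [tuple of behead (p e)]).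
  exact: (measurableT_comp (@measurable_behead _ X k) mp).
rewrite (_ : (fun _ => _) = fun e =>
    (M m t.+1 (y e) (thead (p e)) * G m t.+1 (y e) (thead (p e)) *
     path_density t.+1 (thead (p e)) [tuple of behead (p e)])%R); last first.
  by apply/funext => e; case/tupleP: (p e) => x q; rewrite theadE.
by apply: measurable_funM; [exact: measurable_MG_mul|exact: ih].
Qed.

Lemma measurable_ref_from k t u : measurable_fun [set: k.-tuple X] (fun p => ref_from t p u).
Proof. exact: measurable_coord. Qed.

Lemma lookahead_ext r k t (s : cloud) x x' (g : k.+1.-tuple X -> R) :
  (forall u, (t < u)%N -> x u = x' u) ->
  lookahead m r t s x g = lookahead m r t s x' g.
Proof.
elim: k r t s g => [|k ih] r t s g xx'; first by [].
case: r => [|r]; first by [].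
rewrite /= xx'//; apply: eq_Ex => s1; apply: ih => u tu; apply: xx'.
exact: ltn_trans tu.
Qed.

(** The future of the reference is integrated against its unnormalised density given the position of
    particle 0, while the output is drawn by the sampler. *)
Definition run_mean k t (z : cloud) (g : k.+1.-tuple X -> R) : \bar R :=
  \int[tuple_measure mu k]_p
    (path_density t (thead z).2 p * lookahead m k t z (ref_from t p) g)%:E.

(** The counterpart of [run_mean] in which the output is the reference path itself; invariance says
    that the two agree after averaging over the cloud. *)
Definition path_mean k t (y : X) (g : k.+1.-tuple X -> R) : \bar R :=
  \int[tuple_measure mu k]_p (path_density t y p * g (cons_tuple y p))%:E.

Section means.
Variables (k t : nat).
Hypotheses (t1 : (1 <= t)%N) (tk : (t + k <= T.+1)%N).

Lemma run_mean_ge0 z (g : k.+1.-tuple X -> R) : test g -> 0 <= run_mean t z g.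
Proof.
move=> tg; apply: integral_ge0 => p _; rewrite lee_fin mulr_ge0 ?path_density_ge0//.
by have [_ /(_ z)/andP[]] := test_lookahead1 n hm k (ref_from t p) t1 tk tg.
Qed.

Lemma path_mean_ge0 y (g : k.+1.-tuple X -> R) : test g -> 0 <= path_mean t y g.
Proof.
move=> [_ g01]; apply: integral_ge0 => p _; rewrite lee_fin mulr_ge0 ?path_density_ge0//.
by case/andP: (g01 (cons_tuple y p)).
Qed.

Lemma measurable_run_mean d0 (E : measurableType d0) (z : E -> cloud)
    (g : E -> k.+1.-tuple X -> R) :
  measurable_fun [set: E] z -> test (fun e : E * _ => g e.1 e.2) ->
  measurable_fun [set: E] (fun e => run_mean t (z e) (g e)).
Proof.
move=> mz tg.
have tl : test (fun e : E * k.-tuple X =>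
    lookahead m k t (z e.1) (ref_from t e.2) (g e.1)).
  apply: (@test_lookahead _ _ _ _ _ m n hm k k t _ _ (fun e : E * k.-tuple X => z e.1)
    (fun e => ref_from t e.2) (fun e => g e.1)) => //.
  - exact: (measurableT_comp mz).
  - by move=> u; exact: (measurableT_comp (@measurable_ref_from k t u)).
  have mpr : measurable_fun [set: (E * k.-tuple X) * k.+1.-tuple X]
      (fun e => (e.1.1, e.2)).
    by apply: measurable_fun_pair => //; exact: (measurableT_comp measurable_fst).
  exact: (test_comp tg mpr).
apply: (@measurable_integral_sfinite R _ _ E _ (tuple_measure mu k) (fun e p =>
  (path_density t (thead (z e)).2 p * lookahead m k t (z e) (ref_from t p) (g e))%:E)).
  apply/measurable_EFinP; apply: measurable_funM; last by case: tl.
  apply: measurable_path_density => //.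
  apply: (measurableT_comp (@measurable_val _ _ n ord0)).
  exact: (measurableT_comp mz).
move=> e p; rewrite lee_fin mulr_ge0 ?path_density_ge0//.
by have [_ /(_ (e, p))/andP[]] := tl.
Qed.

Lemma measurable_path_mean d0 (E : measurableType d0) (y : E -> X)
    (g : E -> k.+1.-tuple X -> R) :
  measurable_fun [set: E] y -> test (fun e : E * _ => g e.1 e.2) ->
  measurable_fun [set: E] (fun e => path_mean t (y e) (g e)).
Proof.
move=> my tg.
have my1 : measurable_fun [set: E * k.-tuple X] (fun e => y e.1).
  exact: (measurableT_comp my).
apply: (@measurable_integral_sfinite R _ _ E _ (tuple_measure mu k) (fun e p =>
  (path_density t (y e) p * g e (cons_tuple (y e) p))%:E)).
  apply/measurable_EFinP; apply: measurable_funM.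
    exact: measurable_path_density.
  have mpr : measurable_fun [set: E * k.-tuple X]
      (fun e => (e.1, cons_tuple (y e.1) e.2)).
    by apply: measurable_fun_pair => //; exact: measurable_cons.
  by case: (test_comp tg mpr).
move=> e p; rewrite lee_fin mulr_ge0 ?path_density_ge0//.
by have [_ /(_ (e, cons_tuple (y e) p))/andP[]] := tg.
Qed.

End means.

Lemma integral_propagate t (z : cloud) (f : X * X -> \bar R) : (1 <= t <= T)%N ->
  measurable_fun [set: X * X] f -> (forall u, 0 <= f u) ->
  \int[propagate m t z]_u f u =
  \sum_i (potential m t (tnth z i) / \sum_j potential m t (tnth z j))%:E *
    \int[mu]_x ((M m t.+1 (tnth z i).2 x)%:E * f ((tnth z i).2, x)).
Proof.
move=> /andP[t1 tT] mf f0.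
have tT1 : (2 <= t.+1 <= T.+1)%N by rewrite !ltnS t1.
have mfx y : measurable_fun [set: X] (fun x => f (y, x)).
  by apply: (measurableT_comp mf); exact: measurable_fun_pair.
rewrite integral_bind// integral_categ.
- apply: eq_bigr => i _; congr (_ * _).
  rewrite integral_bind//; last exact: measurable_ret_pair.
  under eq_integral do rewrite integral_ret//.
  by rewrite integral_draw//; exact: M_density.
- by move=> i; apply: (potential_gt0 hm); rewrite t1 leqW.
- by move=> i; exact: integral_ge0.
Qed.

(** The total weight on the right cancels the normalisation of the ancestor's law, and [G m t.+1]
    becomes the potential of the new particle. *)
Lemma sum_propagate t (z : cloud) (h : X * X -> \bar R) : (1 <= t <= T)%N ->
  measurable_fun [set: X * X] h -> (forall u, 0 <= h u) ->
  \sum_i (potential m t (tnth z i))%:E *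
    \int[mu]_x ((M m t.+1 (tnth z i).2 x * G m t.+1 (tnth z i).2 x)%:E *
      h ((tnth z i).2, x)) =
  (\sum_i potential m t (tnth z i))%:E *
    \int[propagate m t z]_u ((potential m t.+1 u)%:E * h u).
Proof.
move=> tT mh h0; case/andP: (tT) => t1 t2.
have tT1 : (1 <= t.+1 <= T.+1)%N by [].
have tT0 : (1 <= t <= T.+1)%N by rewrite t1 leqW.
set W := (\sum_i potential m t (tnth z i))%R.
have W0 : (0 < W)%R by apply: sum_gt0 => i; exact: potential_gt0.
rewrite integral_propagate//.
- rewrite ge0_sume_distrr; last first.
    move=> i _; rewrite mule_ge0//.
      by rewrite lee_fin divr_ge0// ltW// potential_gt0.
    apply: integral_ge0 => x _; apply: mule_ge0.
      by rewrite lee_fin ltW// (M_gt0 hm).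
    by rewrite mule_ge0// lee_fin ltW// potential_gt0.
  apply: eq_bigr => i _; rewrite muleA -EFinM mulrC divfK ?gt_eqF//.
  congr (_ * _); apply: eq_integral => x _; rewrite muleA -EFinM.
  by rewrite /potential eqSS gtn_eqF.
- apply: emeasurable_funM => //; apply/measurable_EFinP.
  exact: measurable_potential.
- by move=> u; rewrite mule_ge0// lee_fin ltW// potential_gt0.
Qed.

Lemma propagate_perm t (z z' : cloud) (f : X * X -> \bar R) : (1 <= t <= T)%N ->
  perm_eq z z' -> measurable_fun [set: X * X] f -> (forall u, 0 <= f u) ->
  \int[propagate m t z]_u f u = \int[propagate m t z']_u f u.
Proof.
move=> tT zz' mf f0; rewrite !integral_propagate//.
rewrite -(sum_tnth_perm (potential m t) zz').
exact: (sum_tnth_perm (fun v => (potential m t v / _)%:E *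
  \int[mu]_x ((M m t.+1 v.2 x)%:E * f (v.2, x))) zz').
Qed.

Lemma back_perm k t (z z' : cloud) (g : k.+2.-tuple X -> R) : perm_eq z z' ->
  back m t z g = back m t z' g.
Proof.
move=> zz'; apply/funext => p; rewrite /back /wavg.
pose w v := (potential m t v * M m t.+1 v.2 (thead p) * G m t.+1 v.2 (thead p))%R.
congr (_ / _)%R.
  exact: (sum_tnth_perm (fun v => w v * g (cons_tuple v.2 p))%R zz').
exact: (sum_tnth_perm w zz').
Qed.

Lemma integral_path_Ex k t (x : X) d0 (B : measurableType d0) (q : giry B R)
    (L : k.-tuple X -> B -> R) :
  (1 <= t)%N -> (t + k <= T.+1)%N -> test (fun e : k.-tuple X * B => L e.1 e.2) ->
  \int[tuple_measure mu k]_p (path_density t x p * Ex q (L p))%:E =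
  \int[q]_b \int[tuple_measure mu k]_p (path_density t x p * L p b)%:E.
Proof.
move=> t1 tk tL.
have tLp p : test (L p).
  by split => [|b]; [exact: (measurable_fun_pair2 p tL.1)|exact: (tL.2 (p, b))].
have L0 e : (0 <= L e.1 e.2)%R by case: tL => _ /(_ e)/andP[].
have mpd : measurable_fun [set: k.-tuple X] (fun p => path_density t x p).
  exact: measurable_path_density.
have mj : measurable_fun [set: k.-tuple X * B] (fun e => (path_density t x e.1 * L e.1 e.2)%:E).
  apply/measurable_EFinP; apply: measurable_funM; last by case: tL.
  exact: (measurableT_comp mpd).
have j0 (e : k.-tuple X * B) : 0 <= (path_density t x e.1 * L e.1 e.2)%:E.
  by rewrite lee_fin mulr_ge0 ?path_density_ge0.
transitivity (\int[tuple_measure mu k]_p \int[q]_b (path_density t x p * L p b)%:E).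
  apply: eq_integral => p _; rewrite EFinM ExE//; last exact: sprobability_setT.
  under [RHS]eq_integral do rewrite EFinM.
  rewrite ge0_integralZl//.
  - by apply/measurable_EFinP; case: (tLp p).
  - by move=> b _; rewrite lee_fin; exact: (L0 (p, b)).
  - by rewrite lee_fin path_density_ge0.
exact: (@fubini_tonelli _ _ _ _ _ (tuple_measure mu k) q
  (fun e => (path_density t x e.1 * L e.1 e.2)%:E) mj j0).
Qed.

(** Separates the next reference particle u from the cloud z, on which the result then depends only
    symmetrically, as exchangeability requires. *)
Definition step_mean k t (z : cloud) (g : k.+2.-tuple X -> R) (u : X * X) : \bar R :=
  \int[iid n (propagate m t z)]_s run_mean t.+1 (cons_tuple u s) (back m t z g).

Section step_mean.
Variables (k t : nat).
Hypotheses (t1 : (1 <= t)%N) (tk : (t + k.+1 <= T.+1)%N).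

Let tT : (1 <= t <= T)%N. Proof. exact: time_lt t1 tk. Qed.
Let tk' : (t.+1 + k <= T.+1)%N. Proof. by rewrite addSnnS. Qed.

Lemma step_mean_ge0 z (g : k.+2.-tuple X -> R) u : test g -> 0 <= step_mean t z g u.
Proof. by move=> tg; apply: integral_ge0 => s _; apply: run_mean_ge0 => //; exact: test_back1. Qed.

Lemma measurable_step_mean d0 (E : measurableType d0) (z : E -> cloud)
    (u : E -> X * X) (g : k.+2.-tuple X -> R) :
  measurable_fun [set: E] z -> measurable_fun [set: E] u -> test g ->
  measurable_fun [set: E] (fun e => step_mean t (z e) g (u e)).
Proof.
move=> mz mu' tg.
apply: (@measurable_integral _ _ _ _ _ (fun e => iid n (propagate m t (z e)))
  (fun e s => run_mean t.+1 (cons_tuple (u e) s) (back m t (z e) g))).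
- exact/measurable_iid/(measurableT_comp (measurable_propagate m tT) mz).
- apply: (@measurable_run_mean k t.+1 isT tk' _ (E * n.-tuple (X * X))%type
    (fun e => cons_tuple (u e.1) e.2) (fun e => back m t (z e.1) g)) => //.
    by apply: measurable_cons => //; exact: (measurableT_comp mu').
  apply: (@test_back _ _ _ _ _ m n hm k t _ (E * n.-tuple (X * X))%type (fun e => z e.1)
    (fun=> g)) => //; first exact: (measurableT_comp mz).
  exact: (test_comp tg).
- by move=> e s; apply: run_mean_ge0 => //; exact: test_back1.
Qed.

Lemma run_meanS z (g : k.+2.-tuple X -> R) : test g ->
  run_mean t z g =
  \int[mu]_x ((M m t.+1 (thead z).2 x * G m t.+1 (thead z).2 x)%:E *
    step_mean t z g ((thead z).2, x)).
Proof.
move=> tg; have tB := test_back1 hm z tT tg.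
set y := (thead z).2.
have tl : test (fun e : k.+1.-tuple X => lookahead m k.+1 t z (ref_from t e) g).
  apply: (@test_lookahead _ _ _ _ _ m n hm k.+1 k.+1 t _ _ (fun=> z)
    (fun p => ref_from t p) (fun=> g)) => //.
  - by move=> u; exact: measurable_ref_from.
  - exact: (test_comp tg).
rewrite /run_mean integral_tuple_measureS; last 2 first.
- apply/measurable_EFinP; apply: measurable_funM; last by case: tl.
  exact: measurable_path_density.
- move=> p; rewrite lee_fin mulr_ge0 ?path_density_ge0//.
  by have [_ /(_ p)/andP[]] := tl.
apply: eq_integral => x _.
have c0 := MG_ge0 y x tT.
pose c := (M m t.+1 y x * G m t.+1 y x)%R.
pose L (p : k.-tuple X) (s : n.-tuple (X * X)) :=
  lookahead m k t.+1 (cons_tuple (y, x) s) (ref_from t.+1 p) (back m t z g).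
have tL : test (fun e : k.-tuple X * n.-tuple (X * X) => L e.1 e.2).
  apply: (@test_lookahead _ _ _ _ _ m n hm k k t.+1 _ (k.-tuple X * n.-tuple (X * X))%type
    (fun e => cons_tuple (y, x) e.2) (fun e => ref_from t.+1 e.1) (fun=> back m t z g)) => //.
  - by apply: measurable_cons.
  - by move=> u; exact: (measurableT_comp (@measurable_ref_from k t.+1 u)).
  - exact: (test_comp tB).
have LE p : lookahead m k.+1 t z (ref_from t (cons_tuple x p)) g =
    Ex (iid n (propagate m t z)) (L p).
  rewrite /= Ex_step; last exact: test_lookahead1.
  rewrite [ref_from _ _ t.+1](_ : _ = x); last first.
    by rewrite /ref_from /Defs.coord subSnn.
  apply: eq_Ex => s; apply: lookahead_ext => u tu.
  rewrite /ref_from /Defs.coord.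
  by rewrite -(subnSK (ltnW tu)) -(subnSK tu).
transitivity (\int[tuple_measure mu k]_p
    (c%:E * (path_density t.+1 x p * Ex (iid n (propagate m t z)) (L p))%:E)).
  by apply: eq_integral => p _; rewrite LE /= -mulrA EFinM.
have [mE E01] := test_Ex (m := fun=> iid n (propagate m t z)) (measurable_cst _) tL.
rewrite ge0_integralZl//.
- by rewrite integral_path_Ex//; congr (_ * _); apply: eq_integral => s _.
- apply/measurable_EFinP; apply: measurable_funM => //; exact: measurable_path_density.
- move=> p _; rewrite lee_fin mulr_ge0 ?path_density_ge0//.
  by case/andP: (E01 p).
Qed.

Lemma path_meanS y (g : k.+2.-tuple X -> R) : test g ->
  path_mean t y g =
  \int[mu]_x ((M m t.+1 y x * G m t.+1 y x)%:E *
    path_mean t.+1 x (fun p => g (cons_tuple y p))).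
Proof.
move=> tg; have [mg g01] := tg.
have g0 p : (0 <= g p)%R by case/andP: (g01 p).
have mgy j (h : X) : measurable_fun [set: j.-tuple X] (fun p => cons_tuple h p).
  exact: measurable_cons.
rewrite /path_mean integral_tuple_measureS; last 2 first.
- apply/measurable_EFinP; apply: measurable_funM; first exact: measurable_path_density.
  exact: (measurableT_comp mg (mgy _ y)).
- by move=> p; rewrite lee_fin mulr_ge0 ?path_density_ge0.
apply: eq_integral => x _; rewrite -ge0_integralZl//.
- by apply: eq_integral => p _; rewrite /= -mulrA EFinM.
- apply/measurable_EFinP; apply: measurable_funM; first exact: measurable_path_density.
  apply: (measurableT_comp mg).
  exact: (measurableT_comp (mgy _ y) (mgy _ x)).
- by move=> p _; rewrite lee_fin mulr_ge0 ?path_density_ge0.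
- by rewrite lee_fin MG_ge0.
Qed.

(** For fixed x and p, the forward weight times M G is the backward weight of particle i. Since
    [back m t z g] does not depend on i, these weights add up to its denominator, and what remains
    is its numerator. *)
Lemma sum_back_path_mean (z : cloud) (g : k.+2.-tuple X -> R) : test g ->
  \sum_i (potential m t (tnth z i))%:E *
    \int[mu]_x ((M m t.+1 (tnth z i).2 x * G m t.+1 (tnth z i).2 x)%:E *
      path_mean t.+1 x (back m t z g)) =
  \sum_i (potential m t (tnth z i))%:E * path_mean t (tnth z i).2 g.
Proof.
move=> tg; have tB := test_back1 hm z tT tg.
have tT0 : (1 <= t <= T.+1)%N by case/andP: tT => -> /leqW.
have pot0 i : 0 <= (potential m t (tnth z i))%:E by rewrite lee_fin ltW// potential_gt0.
have mgy (y : X) : measurable_fun [set: k.+1.-tuple X] (fun p => cons_tuple y p).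
  exact: measurable_cons.
have tgi i : test (fun p => g (cons_tuple (tnth z i).2 p)).
  exact: (test_comp tg (mgy _)).
pose c i x := (potential m t (tnth z i) *
  (M m t.+1 (tnth z i).2 x * G m t.+1 (tnth z i).2 x))%R.
have c0 i x : (0 <= c i x)%R.
  by rewrite mulr_ge0 ?MG_ge0// ltW// potential_gt0.
have mc i : measurable_fun [set: X] (c i).
  by apply: measurable_funM => //; exact: measurable_MG_mul.
(* The sum over particles is moved inside both integrals, so that the cancellation can be done
   pointwise. *)
have gather (h : 'I_n.+1 -> k.+1.-tuple X -> R) : (forall i, test (h i)) ->
    \sum_i (potential m t (tnth z i))%:E *
      \int[mu]_x ((M m t.+1 (tnth z i).2 x * G m t.+1 (tnth z i).2 x)%:E *
        path_mean t.+1 x (h i)) =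
    \int[mu]_x \int[tuple_measure mu k]_p
      (path_density t.+1 x p * \sum_i c i x * h i (cons_tuple x p))%:E.
  move=> th.
  have mpm i : measurable_fun [set: X] (fun x => path_mean t.+1 x (h i)).
    apply: (@measurable_path_mean k t.+1 _ _ _ _ id (fun=> h i)) => //.
    exact: (test_comp (th i)).
  have pm0 i x : 0 <= path_mean t.+1 x (h i) by exact: path_mean_ge0.
  transitivity (\sum_i \int[mu]_x ((c i x)%:E * path_mean t.+1 x (h i))).
    apply: eq_bigr => i _; rewrite -ge0_integralZl//.
    - by apply: eq_integral => x _; rewrite muleA -EFinM.
    - apply: emeasurable_funM => //; apply/measurable_EFinP.
      exact: measurable_MG_mul.
    - by move=> x _; rewrite mule_ge0// lee_fin MG_ge0.
  rewrite -ge0_integral_sum//; last 2 first.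
  - by move=> i; apply: emeasurable_funM => //; exact/measurable_EFinP.
  - by move=> i x _; rewrite mule_ge0// lee_fin.
  apply: eq_integral => x _.
  have h0 i p : (0 <= h i p)%R by case: (th i) => _ /(_ p)/andP[].
  have mhp i : measurable_fun [set: k.-tuple X]
      (fun p => (path_density t.+1 x p * h i (cons_tuple x p))%:E).
    apply/measurable_EFinP; apply: measurable_funM; first exact: measurable_path_density.
    apply: (measurableT_comp (th i).1); exact: measurable_cons.
  have pd0 p : (0 <= path_density t.+1 x (p : k.-tuple X))%R by exact: path_density_ge0.
  transitivity (\sum_i \int[tuple_measure mu k]_p
      ((c i x)%:E * (path_density t.+1 x p * h i (cons_tuple x p))%:E)).
    apply: eq_bigr => i _; rewrite ge0_integralZl//.
      by move=> p _; rewrite lee_fin mulr_ge0.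
    by rewrite lee_fin.
  rewrite -ge0_integral_sum//; last 2 first.
  - by move=> i; exact: emeasurable_funM.
  - by move=> i p _; apply: mule_ge0; rewrite lee_fin// mulr_ge0.
  apply: eq_integral => p _.
  rewrite mulr_sumr -sumEFin; apply: eq_bigr => i _.
  by rewrite -EFinM mulrCA.
rewrite gather//.
under [RHS]eq_bigr do rewrite path_meanS//.
rewrite (gather (fun i p => g (cons_tuple (tnth z i).2 p)) tgi).
apply: eq_integral => x _; apply: eq_integral => p _; congr (_ * _)%:E.
have cE i : c i x = back_weight m t z x i by rewrite /c mulrA.
rewrite -mulr_suml (eq_bigr _ (fun i _ => cE i)) mulrC /back theadE divfK.
  by apply: eq_bigr => i _; rewrite cE.
by rewrite gt_eqF// sum_gt0// => i; exact: back_weight_gt0.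
Qed.

End step_mean.

(* The left-hand side does not change when particle 0 is replaced by the average
   over all particles, by exchangeability; then the normalisations of the forward
   and of the backward weights cancel. *)
Lemma run_invariant k t (q : giry (X * X)%type R) (g : k.+1.-tuple X -> R) :
  q [set: X * X] = 1 -> (1 <= t)%N -> (t + k <= T.+1)%N -> test g ->
  \int[iid n.+1 q]_z ((potential m t (thead z))%:E * run_mean t z g) =
  \int[q]_u ((potential m t u)%:E * path_mean t u.2 g).
Proof.
elim: k t q g => [|k ih] t q g q1 t1 tk tg.
all: have tT0 : (1 <= t <= T.+1)%N by lia.
all: have mpot := @measurable_potential _ _ _ _ _ m t tT0.
all: have pot0 u : 0 <= (potential m t u)%:E by rewrite lee_fin ltW// potential_gt0.
all: have mpm : measurable_fun [set: X * X] (fun u => path_mean t u.2 g).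
  1,3: by apply: (@measurable_path_mean _ _ _ _ _ _ snd (fun=> g)) => //; exact: (test_comp tg).
all: have pm0 y : 0 <= path_mean t y g by exact: path_mean_ge0.
all: pose psi (u : X * X) (_ : cloud) := (potential m t u)%:E * path_mean t u.2 g.
all: have mpsi : measurable_fun [set: X * X] (fun u => (potential m t u)%:E * path_mean t u.2 g).
  1,3: by apply: emeasurable_funM => //; exact/measurable_EFinP.
all: rewrite -(integral_iid_thead n q1 mpsi); last by move=> u; rewrite mule_ge0.
- pose phi (u : X * X) (z : cloud) := (potential m t u)%:E * run_mean t z g.
  have rmE z : run_mean t z g =
      (wavg (fun i => potential m t (tnth z i)) (fun j => g [tuple (tnth z j).2]))%:E.
    by rewrite /run_mean integral_tuple_measure0//= mul1r.
  apply: (@iid_exchange_eq _ _ _ _ _ phi psi).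
  + apply: emeasurable_funM; first exact/measurable_EFinP/(measurableT_comp mpot).
    apply: (@measurable_run_mean 0 t t1 tk _ (X * X * cloud)%type snd (fun=> g)) => //.
    exact: (test_comp tg).
  + exact: (measurableT_comp mpsi).
  + by move=> u z; rewrite mule_ge0// run_mean_ge0.
  + by move=> u z; rewrite mule_ge0.
  + move=> u z z' zz'; rewrite /phi !rmE /wavg.
    rewrite (sum_tnth_perm (potential m t) zz').
    by rewrite (sum_tnth_perm (fun v => potential m t v * g [tuple v.2])%R zz').
  + by [].
  + move=> z; rewrite /phi /psi rmE; under eq_bigr do rewrite -EFinM.
    rewrite sumEFin -mulr_suml /wavg mulrC divfK; last first.
      by rewrite gt_eqF// sum_gt0// => i; exact: potential_gt0.
    rewrite -sumEFin; apply: eq_bigr => i _.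
    by rewrite /path_mean integral_tuple_measure0//= mul1r EFinM.
have tT := time_lt t1 tk.
have tk' : (t.+1 + k <= T.+1)%N by rewrite addSnnS.
(* By [run_meanS], particle 0 enters only through its position and weight; the rest depends
   symmetrically on the cloud. *)
pose phi (u : X * X) (z : cloud) := (potential m t u)%:E *
  \int[mu]_x ((M m t.+1 u.2 x * G m t.+1 u.2 x)%:E * step_mean t z g (u.2, x)).
have MG0 y x : 0 <= (M m t.+1 y x * G m t.+1 y x)%:E by rewrite lee_fin MG_ge0.
have sm0 z v : 0 <= step_mean t z g v by exact: step_mean_ge0.
transitivity (\int[iid n.+1 q]_z phi (thead z) z).
  by apply: eq_integral => z _; rewrite run_meanS.
apply: (@iid_exchange_eq _ _ _ _ _ phi psi).
- apply: emeasurable_funM; first exact/measurable_EFinP/(measurableT_comp mpot).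
  apply: (@measurable_integral_sfinite R _ _ _ _ mu (fun (e : (X * X) * cloud) x =>
    (M m t.+1 e.1.2 x * G m t.+1 e.1.2 x)%:E * step_mean t e.2 g (e.1.2, x))).
    have m12 : measurable_fun [set: ((X * X) * cloud) * X] (fun e => e.1.1.2).
      apply: (measurableT_comp measurable_snd).
      exact: (measurableT_comp measurable_fst).
    apply: emeasurable_funM; first exact/measurable_EFinP/measurable_MG_mul.
    apply: measurable_step_mean => //; first exact: (measurableT_comp measurable_snd).
    exact: measurable_fun_pair.
  by move=> e x; rewrite mule_ge0.
- exact: (measurableT_comp mpsi).
- move=> u z; apply: mule_ge0; first exact: pot0.
  by apply: integral_ge0 => x _; apply: mule_ge0; [exact: MG0|exact: sm0].
- by move=> u z; apply: mule_ge0; [exact: pot0|exact: pm0].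
- move=> u z z' zz'.
  suff E x : step_mean t z g (u.2, x) = step_mean t z' g (u.2, x).
    by rewrite /phi; apply: congr1; apply: eq_integral => x _; rewrite E.
  rewrite /step_mean (back_perm _ _ zz').
  have tB := test_back1 hm z' tT tg.
  apply: integral_iid_ext => [h mh h0| |s]; first exact: propagate_perm.
    apply: (@measurable_run_mean k t.+1 isT tk' _ (n.-tuple (X * X))%type
      (fun s => cons_tuple (u.2, x) s) (fun=> back m t z' g)) => //.
      exact: measurable_cons.
    exact: (test_comp tB).
  exact: run_mean_ge0.
- by [].
move=> z; have tB := test_back1 hm z tT tg.
have mstep : measurable_fun [set: X * X] (step_mean t z g).
  exact: (@measurable_step_mean k t t1 tk _ _ (fun=> z) id).
rewrite /phi /psi (@sum_propagate t z _ tT mstep (sm0 z)).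
have msm : measurable_fun [set: cloud] (fun s => run_mean t.+1 s (back m t z g)).
  apply: (@measurable_run_mean k t.+1 isT tk' _ cloud id (fun=> back m t z g)) => //.
  exact: (test_comp tB).
have tT1 : (1 <= t.+1 <= T.+1)%N by case/andP: tT.
have mpot1 := @measurable_potential _ _ _ _ _ m t.+1 tT1.
have pot10 u : 0 <= (potential m t.+1 u)%:E by rewrite lee_fin ltW// potential_gt0.
(* The new reference u, now drawn from the same law as the n free particles, joins them: the n + 1
   particles are i.i.d., and the induction hypothesis applies with [q := propagate m t z]. *)
rewrite [X in _ * X](_ : _ = \int[iid n.+1 (propagate m t z)]_s
    ((potential m t.+1 (thead s))%:E * run_mean t.+1 s (back m t z g))); last first.
  rewrite integral_iidS; last 2 first.
  - apply: emeasurable_funM => //; apply/measurable_EFinP.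
    exact: (measurableT_comp mpot1 (measurable_tnth ord0)).
  - by move=> s; rewrite mule_ge0// run_mean_ge0.
  apply: eq_integral => u _; rewrite /step_mean.
  have mcu : measurable_fun [set: n.-tuple (X * X)%type] (fun s => cons_tuple u s).
    exact: measurable_cons.
  rewrite -(ge0_integralZl _ (measurableT) (measurableT_comp msm mcu))//.
  by move=> s _; apply: run_mean_ge0.
rewrite (ih t.+1 _ _ (propagate_setT hm z tT) isT tk' tB) -sum_back_path_mean//.
rewrite -(@sum_propagate t z (fun u => path_mean t.+1 u.2 (back m t z g)) tT)//.
- apply: (@measurable_path_mean k t.+1 isT tk' _ (X * X)%type snd (fun=> back m t z g)) => //.
  exact: (test_comp tB).
- by move=> u; exact: path_mean_ge0.
Qed.

End invariance.

(** * Ratio bounds for the weights under strong mixing *)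

Section mixing_bounds.
Context d (X : measurableType d) (R : realType).
Variable mu : {sigma_finite_measure set X -> \bar R}.
Context T (m : model mu T.+1) (n : nat).
Hypothesis hm : strong_mixing m.
Variable eps : R.
Hypothesis eps_gt0 : 0 < eps.
Hypothesis eps_le : eps <= mixing_eps m.

(** A positive infimum, a finite supremum and one value in between make both bounds real numbers, so
    [fine] is faithful. *)
Lemma fine_inf_sup (U : Type) (f : U -> R) (u : U) :
  (0 < ereal_inf (range (fun x => (f x)%:E)))%E ->
  (ereal_sup (range (fun x => (f x)%:E)) < +oo)%E ->
  0 < fine (ereal_inf (range (fun x => (f x)%:E))) /\
  (forall v, fine (ereal_inf (range (fun x => (f x)%:E))) <= f v <=
             fine (ereal_sup (range (fun x => (f x)%:E)))).
Proof.
set i := ereal_inf _; set s := ereal_sup _ => i0 sy.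
have iv v : (i <= (f v)%:E)%E by apply: ereal_inf_lbound; exists v.
have vs v : ((f v)%:E <= s)%E by apply: ereal_sup_ubound; exists v.
have fi : i \is a fin_num.
  by rewrite ge0_fin_numE ?(ltW i0)// (le_lt_trans (iv u))// ltry.
have fs : s \is a fin_num.
  rewrite ge0_fin_numE// (le_trans _ (vs u))// (le_trans (ltW i0))//.
split; first by rewrite -lte_fin fineK.
by move=> v; rewrite -!lee_fin !fineK// iv vs.
Qed.

Lemma potential_bounds t : (1 <= t <= T.+1)%N ->
  0 < fine (G_inf m t) /\
  (forall z, fine (G_inf m t) <= potential m t z <= fine (G_sup m t)).
Proof.
move=> tT; have [+ +] := hm.1 t tT; rewrite /G_inf /G_sup /potential.
case: ifP => _ i0 sy.
  have [h1 h2] := fine_inf_sup point i0 sy; split => // z; exact: h2.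
have [h1 h2] := fine_inf_sup (f := fun z => G m t z.1 z.2) (point, point) i0 sy.
by split => // z; exact: h2.
Qed.

Lemma M_bounds t : (2 <= t <= T.+1)%N ->
  0 < fine (M_inf m t) /\
  (forall x y, fine (M_inf m t) <= M m t x y <= fine (M_sup m t)).
Proof.
move=> tT; have [i0 sy] := hm.2 t tT.
have [h1 h2] := fine_inf_sup (f := fun z => M m t z.1 z.2) (point, point) i0 sy.
by split => // x y; exact: (h2 (x, y)).
Qed.

Lemma mixing_ratio_bound t : (1 <= t <= T)%N ->
  eps * (fine (G_sup m t) * fine (M_sup m t.+1) * fine (G_sup m t.+1)) <=
  fine (G_inf m t) * fine (M_inf m t.+1) * fine (G_inf m t.+1).
Proof.
move=> /andP[t1 tT].
have tT0 : (1 <= t <= T.+1)%N by rewrite t1 leqW.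
have tT1 : (1 <= t.+1 <= T.+1)%N by [].
have tT2 : (2 <= t.+1 <= T.+1)%N by rewrite !ltnS t1.
have [a1 a2] := potential_bounds tT0.
have [b1 b2] := potential_bounds tT1.
have [c1 c2] := M_bounds tT2.
have a3 : 0 < fine (G_sup m t) by case/andP: (a2 (point, point)); lra.
have b3 : 0 < fine (G_sup m t.+1) by case/andP: (b2 (point, point)); lra.
have c3 : 0 < fine (M_sup m t.+1) by case/andP: (c2 point point); lra.
rewrite -ler_pdivlMr ?mulr_gt0// (le_trans eps_le)// /mixing_eps eqSS.
rewrite gtn_eqF ?(leq_trans t1)//.
by apply: (@bigmin_inf_seq _ _ _ _ _ t) => //; rewrite mem_index_iota ltnS t1.
Qed.

(** The ratio at time t contains G_t; its other factors are dropped since an infimum is at most the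
    supremum. At the horizon T + 1 the ratio at time T is used, which contains the potential of the
    next time. *)
Lemma potential_ratio t z z' : (1 <= t <= T.+1)%N ->
  eps * potential m t z <= potential m t z'.
Proof.
move=> tT.
have [a1 a2] := potential_bounds tT.
suff H : eps * fine (G_sup m t) <= fine (G_inf m t).
  case/andP: (a2 z) => _ h1; case/andP: (a2 z') => h2 _.
  by rewrite (le_trans _ h2)// (le_trans _ H)// ler_pM2l.
have a3 : 0 < fine (G_sup m t) by case/andP: (a2 (point, point)); lra.
have [tT'|] := leqP t T; last first.
  move=> Tt; have tE : t = T.+1 by lia.
  (* With horizon 1 there is no earlier ratio, and [mixing_eps] is G_inf / G_sup by its separate
     clause. *)
  have [T0|T0] := posnP T.
    have tE1 : t = 1%N by rewrite tE T0.
    move: eps_le; rewrite /mixing_eps (_ : T.+1 == 1%N); last by rewrite T0.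
    by rewrite -ler_pdivlMr// tE1.
  have TT : (1 <= T <= T)%N by rewrite T0 leqnn.
  have := mixing_ratio_bound TT.
  have [|b1 b2] := @potential_bounds T; first by rewrite T0 leqnSn.
  have [|c1 c2] := @M_bounds T.+1; first by rewrite ltnS T0 leqnn.
  case/andP: (b2 (point, point)) => b3 b4; case/andP: (c2 point point) => c3 c4.
  rewrite tE => H.
  have H1 : fine (G_inf m T) * fine (M_inf m T.+1) <= fine (G_sup m T) * fine (M_sup m T.+1).
    by apply: ler_pM; [exact: ltW|exact: ltW|exact: le_trans b4|exact: le_trans c4].
  have P0 : 0 < fine (G_sup m T) * fine (M_sup m T.+1).
    by apply: lt_le_trans H1; exact: mulr_gt0.
  rewrite -(ler_pM2l P0) mulrCA (le_trans H)// ler_wpM2r//.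
  by apply: ltW; have [] := @potential_bounds T.+1; rewrite ?leqnn.
have tt : (1 <= t <= T)%N by case/andP: tT => ->.
have := mixing_ratio_bound tt => H.
have [|b1 b2] := @potential_bounds t.+1; first by [].
have [|c1 c2] := @M_bounds t.+1; first by case/andP: tt => t1 _; rewrite !ltnS t1.
case/andP: (b2 (point, point)) => b3 b4; case/andP: (c2 point point) => c3 c4.
have H1 : fine (M_inf m t.+1) * fine (G_inf m t.+1) <= fine (M_sup m t.+1) * fine (G_sup m t.+1).
  by apply: ler_pM; [exact: ltW|exact: ltW|exact: le_trans c4|exact: le_trans b4].
have P0 : 0 < fine (M_sup m t.+1) * fine (G_sup m t.+1).
  by apply: lt_le_trans H1; exact: mulr_gt0.
rewrite -(ler_pM2r P0).
have -> : eps * fine (G_sup m t) * (fine (M_sup m t.+1) * fine (G_sup m t.+1)) =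
    eps * (fine (G_sup m t) * fine (M_sup m t.+1) * fine (G_sup m t.+1)).
  by rewrite !mulrA.
by rewrite (le_trans H)// -mulrA ler_wpM2l// ltW.
Qed.

(** The three factors of a backward weight are those bounded in [mixing_ratio]; hence the bound
    holds across different clouds and different later positions. *)
Lemma back_weight_ratio t (s s' : n.+1.-tuple (X * X)) y y' i j : (1 <= t <= T)%N ->
  eps * back_weight m t s y i <= back_weight m t s' y' j.
Proof.
move=> tT; have H := mixing_ratio_bound tT; case/andP: tT => t1 tT.
have [|a1 a2] := @potential_bounds t; first by rewrite t1 leqW.
have [|b1 b2] := @potential_bounds t.+1; first by [].
have [|c1 c2] := @M_bounds t.+1; first by rewrite !ltnS t1.
have GE v w : G m t.+1 v w = potential m t.+1 (v, w).
  by rewrite /potential eqSS gtn_eqF.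
rewrite /back_weight !GE.
case/andP: (a2 (tnth s i)) => a3 a4; case/andP: (a2 (tnth s' j)) => a5 a6.
case/andP: (b2 ((tnth s i).2, y)) => b3 b4; case/andP: (b2 ((tnth s' j).2, y')) => b5 b6.
case/andP: (c2 (tnth s i).2 y) => c3 c4; case/andP: (c2 (tnth s' j).2 y') => c5 c6.
have a0 : 0 <= potential m t (tnth s i) by lra.
have b0 : 0 <= potential m t.+1 ((tnth s i).2, y) by lra.
have c0 : 0 <= M m t.+1 (tnth s i).2 y by lra.
apply: le_trans (le_trans H _).
  rewrite ler_pM2l//; apply: ler_pM => //; first exact: mulr_ge0.
  exact: ler_pM.
apply: ler_pM => //; [by rewrite mulr_ge0// ltW|exact: ltW|].
by apply: ler_pM => //; exact: ltW.
Qed.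

End mixing_bounds.

(** * Invariance of the target under the full sampler *)

Section cbpf_invariance.
Context d (X : measurableType d) (R : realType).
Variable mu : {sigma_finite_measure set X -> \bar R}.
Context T (m : model mu T.+1) (n : nat).
Hypothesis hm : strong_mixing m.
Local Open Scope ereal_scope.

Lemma prod_path_density k t (y : X) (p : seq X) (c : nat -> X) :
  c t = y -> (forall i, (i < k)%N -> c (t.+1 + i)%N = nth point p i) -> size p = k ->
  (\prod_(t.+1 <= u < t.+1 + k) (M m u (c u.-1) (c u) * G m u (c u.-1) (c u)) =
   path_density m t y p)%R.
Proof.
elim: k t y p => [|k ih] t y p ct cp.
  by move=> /size0nil ->; rewrite addn0 big_geq.
case: p cp => // x p cp [sp]; rewrite big_ltn; last by lia.
have ct1 : c t.+1 = x by rewrite -[t.+1]addn0 cp.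
rewrite /= ct ct1 -addSnnS (ih t.+1 x p)// => i ik.
by rewrite addSnnS cp.
Qed.

Lemma gamma_cons x (p : T.-tuple X) :
  (gamma m (cons_tuple x p) = M1 m x * G1 m x * path_density m 1 x p)%R.
Proof.
rewrite /gamma /path_weight; congr (_ * _)%R.
have := @prod_path_density T 1 x p (Defs.coord (cons_tuple x p)).
by rewrite add2n; apply => //; rewrite size_tuple.
Qed.

(** The factor M_1 of gamma makes the first reference position one more draw from the initial law q,
    so that the initial cloud consists of n + 1 i.i.d. particles; G_1 is the potential of particle
    0, and the rest of gamma is [path_density]. This is the situation of [run_invariant] at time
    1. *)
Lemma gamma_Ex_cbpf (f : T.+1.-tuple X -> R) : test f ->
  \int[tuple_measure mu T.+1]_x (gamma m x * Ex (cbpf m n x) f)%:E =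
  \int[tuple_measure mu T.+1]_x (gamma m x * f x)%:E.
Proof.
move=> tf; have [mf f01] := tf.
have f0 p : (0 <= f p)%R by case/andP: (f01 p).
have tP : test (fun x => Ex (cbpf m n x) f).
  apply: test_Ex; first exact: measurable_cbpf.
  exact: (test_comp tf).
have [mP P01] := tP.
have P0 x : (0 <= Ex (cbpf m n x) f)%R by case/andP: (P01 x).
have [mM1 M10 _] := M1_density m.
have mG1 := G1_measurable m.
pose q : giry (X * X)%type R := bind (draw mu (M1 m)) (fun y => giry_ret (y, y)).
have q1 : q [set: X * X] = 1.
  apply: bind_setT; [exact: measurable_init_draw| |by move=> y; exact: diracT].
  exact: draw_setT (M1_density m).
have integral_q (h : X * X -> \bar R) : measurable_fun [set: X * X] h ->
    (forall u, 0 <= h u) -> \int[q]_u h u = \int[mu]_x ((M1 m x)%:E * h (x, x)).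
  move=> mh h0; rewrite integral_bind//; last exact: measurable_init_draw.
  under eq_integral do rewrite integral_ret//.
  rewrite integral_draw//; first exact: M1_density.
  have mxx : measurable_fun [set: X] (fun x => (x, x)) by exact: measurable_fun_pair.
  exact: (measurableT_comp mh mxx).
have pot1 u : potential m 1 u = G1 m u.2 by [].
have tk : (1 + T <= T.+1)%N by [].
rewrite !integral_tuple_measureS; last 4 first.
- apply/measurable_EFinP; apply: measurable_funM => //; exact: measurable_gamma.
- by move=> p; rewrite lee_fin mulr_ge0// gamma_ge0.
- apply/measurable_EFinP; apply: measurable_funM => //; exact: measurable_gamma.
- by move=> p; rewrite lee_fin mulr_ge0// gamma_ge0.
pose F (u : X * X) := \int[iid n q]_s run_mean m 1 (cons_tuple u s) f.
have rm0 z : 0 <= run_mean m 1 (z : n.+1.-tuple (X * X)) f by exact: run_mean_ge0.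
have mrm : measurable_fun [set: n.+1.-tuple (X * X)] (fun z => run_mean m 1 z f).
  apply: (@measurable_run_mean _ _ _ _ _ m n hm T 1 isT tk _ _ id (fun=> f)) => //.
  exact: (test_comp tf).
have F0 u : 0 <= F u by exact: integral_ge0.
have mF : measurable_fun [set: X * X] F.
  apply: (@measurable_integral _ _ _ _ _ (fun=> iid n q)
    (fun u s => run_mean m 1 (cons_tuple u s) f)) => //.
  exact: (measurableT_comp mrm (@measurable_cons2 _ _ n)).
have mpot : measurable_fun [set: X * X] (fun u => (potential m 1 u)%:E).
  by apply/measurable_EFinP; exact: measurable_potential.
have pot0 u : 0 <= (potential m 1 u)%:E by rewrite lee_fin pot1 G1_ge0.
transitivity (\int[q]_u ((potential m 1 u)%:E * F u)).
  rewrite integral_q; last 2 first.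
  - exact: emeasurable_funM.
  - by move=> u; exact: mule_ge0.
  apply: eq_integral => x _.
  pose L (p : T.-tuple X) (s : n.-tuple (X * X)) :=
    lookahead m T 1 (cons_tuple (x, x) s) (ref_from 1 p) f.
  have tL : test (fun e : T.-tuple X * n.-tuple (X * X) => L e.1 e.2).
    apply: (@test_lookahead _ _ _ _ _ m n hm T T 1 _ (T.-tuple X * n.-tuple (X * X))%type
      (fun e => cons_tuple (x, x) e.2) (fun e => ref_from 1 e.1) (fun=> f)) => //.
    - exact: measurable_cons.
    - by move=> u; exact: (measurableT_comp (@measurable_ref_from _ _ T 1 u)).
    - exact: (test_comp tf).
  have tl y : test (fun s : n.+1.-tuple (X * X) => lookahead m T 1 s y f).
    exact: test_lookahead1.
  have LE p : Ex (cbpf m n (cons_tuple x p)) f = Ex (iid n q) (L p).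
    rewrite Ex_cbpf// Ex_init//; apply: eq_Ex => s; apply: lookahead_ext => u u1.
    by rewrite /ref_from /Defs.coord; case: u u1 => [|[|u]].
  have [mE E01] := test_Ex (m := fun=> iid n q) (measurable_cst _) tL.
  transitivity (\int[tuple_measure mu T]_p
      ((M1 m x * G1 m x)%:E * (path_density m 1 x p * Ex (iid n q) (L p))%:E)).
    by apply: eq_integral => p _; rewrite LE gamma_cons -mulrA EFinM.
  rewrite ge0_integralZl//.
  - rewrite integral_path_Ex// EFinM -muleA; congr (_ * _); congr (_ * _).
  - apply/measurable_EFinP; apply: measurable_funM => //; exact: measurable_path_density.
  - move=> p _; rewrite lee_fin mulr_ge0 ?path_density_ge0//.
    by case/andP: (E01 p).
  - by rewrite lee_fin mulr_ge0// G1_ge0.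
transitivity (\int[iid n.+1 q]_z ((potential m 1 (thead z))%:E * run_mean m 1 z f)).
  rewrite integral_iidS; last 2 first.
  - apply: emeasurable_funM => //.
    exact: (measurableT_comp mpot (measurable_tnth ord0)).
  - by move=> z; exact: mule_ge0.
  apply: eq_integral => u _; rewrite -ge0_integralZl//.
  have mcu : measurable_fun [set: n.-tuple (X * X)%type] (fun s => cons_tuple u s).
    exact: measurable_cons.
  exact: (measurableT_comp mrm mcu).
rewrite (@run_invariant _ _ _ _ _ m n hm T 1 q f q1 isT tk tf).
have mpm : measurable_fun [set: X * X] (fun u => path_mean m 1 u.2 f).
  apply: (@measurable_path_mean _ _ _ _ _ m hm T 1 isT tk _ _ snd (fun=> f)) => //.
  exact: (test_comp tf).
have pm0 y : 0 <= path_mean m 1 y f by exact: path_mean_ge0.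
rewrite integral_q; last 2 first.
- exact: emeasurable_funM.
- by move=> u; exact: mule_ge0.
apply: eq_integral => x _; rewrite muleA -EFinM /path_mean -ge0_integralZl//.
- by apply: eq_integral => p _; rewrite gamma_cons -EFinM mulrA.
- apply/measurable_EFinP; apply: measurable_funM; first exact: measurable_path_density.
  by apply: (measurableT_comp mf); exact: measurable_cons.
- by move=> p _; rewrite lee_fin mulr_ge0 ?path_density_ge0.
- by rewrite lee_fin mulr_ge0// pot1 G1_ge0.
Qed.

Lemma target_invariant (f : T.+1.-tuple X -> R) : test f ->
  Ex (target m) (fun x => Ex (cbpf m n x) f) = Ex (target m) f.
Proof.
move=> tf.
have tP : test (fun x => Ex (cbpf m n x) f).
  apply: test_Ex; first exact: measurable_cbpf.
  exact: (test_comp tf).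
have c0 : (0 < fine (normc m))%R by rewrite fine_gt0// normc_gt0 normc_lty.
have key g : test g -> \int[target m]_x (g x)%:E =
    ((fine (normc m))^-1)%:E * \int[tuple_measure mu T.+1]_x (gamma m x * g x)%:E.
  move=> [mg g01].
  have g0 x : (0 <= g x)%R by case/andP: (g01 x).
  rewrite integral_draw; last 3 first.
  - exact: target_density.
  - exact/measurable_EFinP.
  - by move=> x; rewrite lee_fin.
  rewrite -ge0_integralZl//.
  - by apply: eq_integral => x _; rewrite -!EFinM mulrAC mulrC.
  - apply/measurable_EFinP; apply: measurable_funM => //; exact: measurable_gamma.
  - by move=> x _; rewrite lee_fin mulr_ge0// gamma_ge0.
  - by rewrite lee_fin invr_ge0 ltW.
by rewrite /Ex key// key// gamma_Ex_cbpf.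
Qed.

End cbpf_invariance.

(** * Convergence *)

Section kernel_powers.
Context d (X : measurableType d) (R : realType).
Variable mu : {sigma_finite_measure set X -> \bar R}.
Context T (m : model mu T.+1) (n : nat).
Hypothesis hm : strong_mixing m.

(** The kernel power written with [bind], so that [Ex_bind] and [test_Ex] apply; it is identified
    with [kpow] in [kpow_cbpf_pow]. *)
Fixpoint cbpf_pow k (x : T.+1.-tuple X) : giry (T.+1.-tuple X) R :=
  if k is k'.+1 then bind (cbpf m n x) (cbpf_pow k') else giry_ret x.

Lemma measurable_cbpf_pow k : measurable_fun [set: T.+1.-tuple X] (cbpf_pow k).
Proof.
elim: k => [|k ih] /=; first exact: measurable_giry_ret.
apply: measurable_bind; first exact: measurable_cbpf.
exact: (measurableT_comp ih).
Qed.

Lemma kpow_cbpf_pow k x U : measurable U ->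
  kpow (cbpf_kernel m n) k x U = cbpf_pow k x U.
Proof.
move=> mU; elim: k x => [|k ih] x //.
rewrite /= bindE//; last exact: measurable_cbpf_pow.
by apply: eq_integral => y _; exact: ih.
Qed.

Lemma Ex_kpow k x (f : T.+1.-tuple X -> R) :
  Ex (kpow (cbpf_kernel m n) k x) f = Ex (cbpf_pow k x) f.
Proof.
congr fine; apply: eq_measure_integral => U mU _.
exact: kpow_cbpf_pow.
Qed.

Lemma Ex_cbpf_powS k x (f : T.+1.-tuple X -> R) : test f ->
  Ex (cbpf_pow k.+1 x) f = Ex (cbpf m n x) (fun y => Ex (cbpf_pow k y) f).
Proof. by move=> tf; rewrite Ex_bind//; exact: measurable_cbpf_pow. Qed.

Lemma test_cbpf_pow k (f : T.+1.-tuple X -> R) : test f ->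
  test (fun x => Ex (cbpf_pow k x) f).
Proof.
move=> tf; apply: test_Ex; first exact: measurable_cbpf_pow.
exact: (test_comp tf).
Qed.

Lemma target_pow_invariant k (f : T.+1.-tuple X -> R) : test f ->
  Ex (target m) (fun x => Ex (cbpf_pow k x) f) = Ex (target m) f.
Proof.
move=> tf; elim: k => [|k ih].
  by apply: eq_Ex => x; rewrite Ex_ret.
rewrite -ih -(target_invariant n hm (test_cbpf_pow k tf)).
by apply: eq_Ex => x; exact: Ex_cbpf_powS.
Qed.

Lemma cbpf_pow_osc alpha c k (f : T.+1.-tuple X -> R) : 0 <= c -> 1 < alpha ->
  (forall g L, 0 <= L -> test g -> path_osc_le alpha g L ->
     path_osc_le alpha (fun x => Ex (cbpf m n x) g) (c * L)) ->
  test f -> path_osc_le alpha (fun x => Ex (cbpf_pow k x) f) (c ^+ k).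
Proof.
move=> c0 a1 H tf; elim: k => [|k ih].
  move=> j x y jT xy; rewrite !Ex_ret// expr0 mul1r.
  (* All powers of alpha involved are at least 1, so a [0,1]-valued function has constant 1. *)
  apply: (@le_trans _ _ 1); last by rewrite exprn_ege1// ltW.
  have [_ f01] := tf; have := f01 x; have := f01 y; rewrite ler_norml; lra.
have := H _ _ (exprn_ge0 k c0) (test_cbpf_pow k tf) ih.
by move=> h j x y jT xy; rewrite !Ex_cbpf_powS// exprS; exact: h.
Qed.

Lemma target_setT : target m [set: T.+1.-tuple X] = 1%E.
Proof. exact: draw_setT (target_density m). Qed.

(** By invariance, the target expectation of f is that of P^k f, so P^k f is compared with its own
    mean; the case j = 0 of [path_osc_le] bounds the difference of any two of its values. *)
Lemma cbpf_pow_target alpha c k x (f : T.+1.-tuple X -> R) : 0 <= c -> 1 < alpha ->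
  (forall g L, 0 <= L -> test g -> path_osc_le alpha g L ->
     path_osc_le alpha (fun x => Ex (cbpf m n x) g) (c * L)) ->
  test f ->
  `|Ex (cbpf_pow k x) f - Ex (target m) f| <= c ^+ k * alpha ^+ T.+1.
Proof.
move=> c0 a1 H tf; have tk := test_cbpf_pow k tf.
rewrite -(target_pow_invariant k tf) distrC; apply: Ex_dev => //.
- exact: target_setT.
- move=> y; have := @cbpf_pow_osc alpha c k f c0 a1 H tf 0%N y x isT.
  by rewrite !take0 subn0; exact.
- by have [_ h01] := tk; exact: h01.
Qed.

End kernel_powers.

(** * Total variation through [0,1]-valued functions *)

Section total_variation.
Context d (Y : measurableType d) (R : realType).
Variables m1 m2 : {measure set Y -> \bar R}.
Hypotheses (m1_le1 : (m1 [set: Y] <= 1)%E) (m2_le1 : (m2 [set: Y] <= 1)%E).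

(* Splitting a function into its positive and negative parts costs the factor 2. *)
Lemma tv_le c : (forall f, test f -> `|Ex m1 f - Ex m2 f| <= c) ->
  (tv m1 m2 <= (2 * c)%:E)%E.
Proof.
move=> H; apply: ge_ereal_sup => _ [f [mf f1] <-].
pose fp y := Num.max (f y) 0; pose fn y := Num.max (- f y) 0.
have tfp : test fp.
  split=> [|y]; first exact: measurable_maxr.
  have := f1 y; rewrite /fp ler_norml => /andP[h1 h2].
  by rewrite le_max lexx orbT ge_max h2 ler01.
have tfn : test fn.
  split=> [|y]; first by apply: measurable_maxr => //; exact: (measurableT_comp (@oppr_measurable R setT) mf).
  have := f1 y; rewrite /fn ler_norml => /andP[h1 h2].
  by rewrite le_max lexx orbT ge_max ler01 andbT lerNl.
have E (m : {measure set Y -> \bar R}) : (m [set: Y] <= 1)%E ->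
    (\int[m]_y (f y)%:E = (Ex m fp - Ex m fn)%:E)%E.
  move=> mle; rewrite integralE EFinB !ExE//; congr (_ - _)%E.
    by apply: eq_integral => y _; rewrite funeposE /= EFin_max.
  by apply: eq_integral => y _; rewrite funenegE /= EFin_max.
rewrite !E// -EFinB lee_fin.
have -> : Ex m1 fp - Ex m1 fn - (Ex m2 fp - Ex m2 fn) =
    (Ex m1 fp - Ex m2 fp) - (Ex m1 fn - Ex m2 fn) by ring.
rewrite (le_trans (ler_normB _ _))// mulr_natl mulr2n lerD//; exact: H.
Qed.

Lemma tv_ge0 : (0 <= tv m1 m2)%E.
Proof.
apply: (@le_trans _ _ `|\int[m1]_y ((cst 0 : Y -> R) y)%:E - \int[m2]_y (cst 0 y)%:E|)%E.
  exact: abse_ge0.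
apply: ereal_sup_ubound; exists (cst 0) => //.
by split => // y; rewrite normr0.
Qed.

End total_variation.

(** * Choice of the depth r and of the number of particles *)

Section constants.
Context (R : realType).

Lemma exists_exp_ge (a x : R) : 1 < a -> exists r, x <= a ^+ r.
Proof.
move=> a1; have a0 : 0 < a by exact: lt_trans a1.
have b (k : nat) : 1 + k%:R * (a - 1) <= a ^+ k.
  elim: k => [|k ih]; first by rewrite mul0r addr0 expr0.
  rewrite exprS (le_trans _ (ler_wpM2l (ltW a0) ih))// -natr1.
  have : 0 <= k%:R * (a - 1) * (a - 1) by rewrite !mulr_ge0 ?subr_ge0// ltW.
  by move=> h; rewrite -subr_ge0 (_ : _ - _ = k%:R * (a - 1) * (a - 1))//; ring.
exists (Num.truncn (`|x| / (a - 1))).+1; apply: le_trans (b _).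
have h : `|x| / (a - 1) < (Num.truncn (`|x| / (a - 1))).+1%:R.
  by rewrite truncnS_gt.
rewrite ltr_pdivrMr ?subr_gt0// in h.
by have := ler_norm x; lra.
Qed.

(** The truncation term is made at most beta / 2 by r alone; the remaining term, with its constants
    now fixed, is made so by n. Absolute values of K and D spare sign conditions. *)
Lemma exists_rate (eps alpha beta : R) : 0 < eps -> 1 < alpha -> 0 < beta ->
  exists r N0, forall n, (N0 <= n)%N -> (0 < n)%N ->
    rate n eps alpha r * alpha <= beta.
Proof.
move=> e0 a1 b0; set K := osc_const eps alpha.
have a0 : 0 < alpha by exact: lt_trans a1.
have [r hr] := exists_exp_ge (4 * (`|K| * alpha) / beta) a1.
pose D := lip_const eps r + ref_const eps r.
exists r, (Num.truncn (2 * (`|K| * alpha * `|D|) / beta)).+1 => n nN n0.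
have Ka0 : 0 <= `|K| * alpha by rewrite mulr_ge0// ltW.
have ar0 : 0 < alpha ^+ r by rewrite exprn_gt0.
have n0' : 0 < n%:R :> R by rewrite ltr0n.
have h1 : `|K| * alpha * (2 / alpha ^+ r) <= beta / 2.
  rewrite ler_pdivrMr// in hr.
  by rewrite mulrA ler_pdivrMr//; lra.
have h2 : `|K| * alpha * (`|D| / n%:R) <= beta / 2.
  have : 2 * (`|K| * alpha * `|D|) / beta < n%:R.
    by apply: lt_le_trans (_ : _.+1%:R <= _); [exact: truncnS_gt|rewrite ler_nat].
  rewrite ltr_pdivrMr// => h.
  by rewrite mulrA ler_pdivrMr//; lra.
rewrite /rate -/K -/D.
apply: (@le_trans _ _ (`|K| * alpha * (2 / alpha ^+ r) + `|K| * alpha * (`|D| / n%:R))).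
  rewrite -mulrDr mulrAC.
  apply: (@le_trans _ _ (`|K * alpha * (2 / alpha ^+ r + D / n%:R)|)).
    exact: ler_norm.
  rewrite normrM normrM (gtr0_norm a0) ler_wpM2l//.
  rewrite (le_trans (ler_normD _ _))// !normrM !normfV.
  by rewrite (ger0_norm (ltW ar0)) (gtr0_norm n0') (gtr0_norm (_ : 0 < 2)).
lra.
Qed.

End constants.

Lemma sup_tv_le (R : realType) (eps : R) : 0 < eps <= 1 ->
  forall alpha beta : R, 1 < alpha -> 1 < beta ->
  exists N0 : nat, forall N, (2 <= N)%N -> (N0 <= N)%N ->
    forall (d : measure_display) (X : measurableType d)
      (mu : {sigma_finite_measure set X -> \bar R}) (T : nat) (m : model mu T.+1),
      strong_mixing m -> eps <= mixing_eps m ->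
      forall k, (1 <= k)%N -> (sup_tv m N k <= (alpha ^+ T.+1 * beta ^- k)%:E)%E.
Proof.
move=> /andP[e0 e1] alpha beta a1 b1.
have b0 : 0 < beta by exact: lt_trans b1.
(* The cap gives (1 - eps) a <= (1 - eps) (1 + eps / 2) < 1, and a <= alpha lets a be replaced by
   alpha at the end. *)
pose a := Num.min alpha (1 + eps / 2).
have a_gt1 : 1 < a by rewrite lt_min a1/=; lra.
have a_gt0 : 0 < a by exact: lt_trans a_gt1.
have a_le : a <= 1 + eps / 2 by rewrite ge_min lexx orbT.
have a_small : (1 - eps) * a < 1.
  apply: (@le_lt_trans _ _ ((1 - eps) * (1 + eps / 2))).
    by rewrite ler_wpM2l// subr_ge0.
  by nra.
(* The rate 1 / (2 beta) absorbs the factor 2 of [tv_le]: as k >= 1, 2 (2 beta)^-k <= beta^-k. *)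
have [|r [N0 HN]] := exists_rate (beta := (2 * beta)^-1) e0 a_gt1.
  by rewrite invr_gt0 mulr_gt0.
exists N0.+1 => N N2 NN0 d X mu T m hm em k k1.
have n0 : (0 < N.-1)%N by case: N N2 {NN0} => [|[]].
have nN : (N0 <= N.-1)%N by case: N N2 NN0 {n0}.
pose c := (2 * beta)^-1.
have c0 : 0 <= c by rewrite invr_ge0 ltW// mulr_gt0.
have H g L : 0 <= L -> test g -> path_osc_le a g L ->
    path_osc_le a (fun x => Ex (cbpf m N.-1 x) g) (c * L).
  move=> L0 tg gL j x y jT xy.
  have := cbpf_contract hm e0 e1 a_gt1 a_small n0
    (potential_ratio hm e0 em) (back_weight_ratio hm e0 em) r L0 tg gL jT xy.
  move=> /le_trans; apply.
  rewrite ler_wpM2r ?exprn_ge0 ?(ltW a_gt0)//.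
  by rewrite ler_wpM2r// HN.
apply: ge_ereal_sup => _ [x _ <-].
apply: (@le_trans _ _ (2 * (c ^+ k * a ^+ T.+1))%:E).
  apply: tv_le => [| |f tf].
  - exact: sprob_kernel_le1.
  - exact: sprobability_setT.
  by rewrite Ex_kpow; exact: cbpf_pow_target.
rewrite lee_fin mulrA mulrC ler_pM//.
- by rewrite exprn_ge0// ltW.
- by rewrite mulr_ge0// exprn_ge0.
- apply: lerXn2r; rewrite ?nnegrE; [exact: ltW|exact/ltW/(lt_trans _ a1)|].
  by rewrite ge_min lexx.
rewrite /c exprVn exprMn invfM mulrA -[leRHS]mul1r ler_pM2r ?invr_gt0 ?exprn_gt0//.
by rewrite ler_pdivrMr ?exprn_gt0// mul1r ler_eXnr// ?lexx// ler1n.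
Qed.

(** Since k is at least rho (T + 1), the bound is at most q^(T+1) with q = alpha beta^-rho, and the
    condition on rho is exactly q < 1. *)
Lemma tv_vanishes_of_sup_tv_le (R : realType) (eps alpha beta rho : R) N :
  1 < alpha -> 1 < beta -> ln alpha / ln beta < rho ->
  (forall (d : measure_display) (X : measurableType d)
     (mu : {sigma_finite_measure set X -> \bar R}) (T : nat) (m : model mu T.+1),
     strong_mixing m -> eps <= mixing_eps m ->
     forall k, (1 <= k)%N -> (sup_tv m N k <= (alpha ^+ T.+1 * beta ^- k)%:E)%E) ->
  tv_vanishes eps rho N.
Proof.
move=> a1 b1 ab H d X mu m hm.
have a0 : 0 < alpha by exact: lt_trans a1.
have b0 : 0 < beta by exact: lt_trans b1.
have lb0 : 0 < ln beta by rewrite ln_gt0.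
have rho0 : 0 < rho by rewrite (le_lt_trans _ ab)// divr_ge0 ?ln_ge0// ltW.
pose q := expR (ln alpha - rho * ln beta).
have q0 : 0 < q by exact: expR_gt0.
have q1 : q < 1.
  by rewrite expR_lt1 subr_lt0 -ltr_pdivrMr.
apply: (@squeeze_cvge _ _ _ _ (fun=> 0%E) _ (fun T => (q ^+ T.+1)%:E)); last 2 first.
- exact: cvg_cst.
- apply: cvg_EFin; first by near=> T.
  rewrite (_ : _ \o _ = fun T => q * q ^+ T); last first.
    by apply/funext => T /=; rewrite exprS.
  rewrite -[X in _ --> X](mulr0 q); apply: cvgMr.
  by apply: cvg_expr; rewrite gtr0_norm.
near=> T; apply/andP; split.
  apply: (@le_trans _ _ (tv (kpow (cbpf_kernel (m T) N.-1)
      `|Num.ceil (rho * T.+1%:R)|%N point) (target (m T)))).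
    exact: tv_ge0.
  by apply: ereal_sup_ubound; exists point.
have rT0 : 0 < rho * T.+1%:R by rewrite mulr_gt0.
set k := `|Num.ceil (rho * T.+1%:R)|%N.
have ck : rho * T.+1%:R <= k%:R.
  have c0 : (0 <= Num.ceil (rho * T.+1%:R))%R by rewrite ltW// ceil_gt0.
  rewrite (le_trans (ceil_ge _))// /k -[in leLHS](gez0_abs c0).
  by [].
have k1 : (1 <= k)%N by rewrite -(ltr_nat R) (lt_le_trans rT0).
have [hT eT] := hm T.
apply: le_trans (H _ _ _ _ _ hT eT _ k1) _; rewrite lee_fin.
rewrite -[in leLHS](lnK (a0 : alpha \is Num.pos)) -[in leLHS](lnK (b0 : beta \is Num.pos)).
rewrite -!expRM_natl -expRN -expRD ler_expR.
rewrite mulrBr lerD2l lerN2 [T.+1%:R * _]mulrCA mulrA.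
by rewrite ler_pM2r.
Unshelve. all: by end_near.
Qed.
Unset Implicit Arguments.

Theorem theorem4 (R : realType) (eps : R) (heps : 0 < eps <= 1) :
  (forall rho : R, 0 < rho ->
     exists N0 : nat, forall N : nat, (2 <= N)%N -> (N0 <= N)%N ->
       tv_vanishes eps rho N)
  /\
  (forall alpha beta : R, 1 < alpha -> 1 < beta ->
     exists N0 : nat, forall N : nat, (2 <= N)%N -> (N0 <= N)%N ->
       (forall (d : measure_display) (X : measurableType d)
          (mu : {sigma_finite_measure set X -> \bar R})
          (T : nat) (m : model mu T.+1),
          strong_mixing m -> eps <= mixing_eps m ->
          forall k : nat, (1 <= k)%N ->
            (sup_tv m N k <= (alpha ^+ T.+1 * beta ^- k)%:E)%E)
       /\
       (forall rho : R, ln alpha / ln beta < rho -> tv_vanishes eps rho N)).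
Proof.
suff main (alpha beta : R) : 1 < alpha -> 1 < beta ->
    exists N0 : nat, forall N : nat, (2 <= N)%N -> (N0 <= N)%N ->
      (forall (d : measure_display) (X : measurableType d)
         (mu : {sigma_finite_measure set X -> \bar R})
         (T : nat) (m : model mu T.+1),
         strong_mixing m -> eps <= mixing_eps m ->
         forall k : nat, (1 <= k)%N ->
           (sup_tv m N k <= (alpha ^+ T.+1 * beta ^- k)%:E)%E)
      /\
      (forall rho : R, ln alpha / ln beta < rho -> tv_vanishes eps rho N).
  split=> // rho rho0.
  (* With these values ln alpha / ln beta = rho / 2 < rho. *)
  have [||N0 HN] := main (expR (rho / 2)) (expR 1); rewrite ?expR_gt1 ?divr_gt0//.
  exists N0 => N N2 NN0; apply: (HN N N2 NN0).2.
  by rewrite !expRK divr1; lra.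
move=> a1 b1; have [N0 HN] := sup_tv_le heps a1 b1.
exists N0 => N N2 NN0; have H := HN N N2 NN0; split=> // rho ab.
exact: tv_vanishes_of_sup_tv_le a1 b1 ab H.
Qed.
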